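(* Let $a<b$ be real numbers, $\delta(x)=\min\{b-x,x-a\}$ for $x\in[a,b]$, and $\delta_0=\frac{b-a}{2}$. Let $p\ge1$, $r\in[1,p]$, and let $g$ be an absolutely continuous function on $[a,b]$ such that $g(a)=g(b)=0$. (i) If $m>1$, $\nu\in[0,1/m]$ and $\lambda\in\left[0,\frac{1+\nu m}{2}\right)$, then $$(1-r\nu^2m^2)\int_a^b\frac{|g(x)|^p}{\delta(x)^2}\,dx+\frac{4r\left(c_\nu^2(m)+(m-1)(\lambda-\lambda^2)\right)}{\delta_0^m}\int_a^b\frac{|g(x)|^p}{\delta(x)^{2-m}}\,dx\le p^r\left(2(1+\nu m)-4\lambda^2\right)^r\int_a^b\frac{|g(x)|^{p-r}|g'(x)|^r}{\delta(x)^{2-r}}\,dx.$$ (ii) If $m>1$, $\nu\in[0,1/m)$ and $\lambda\in\left[0,\frac{1+\nu m}{2}\right)$, then $$\int_a^b\frac{|g(x)|^p}{\delta(x)^2}\,dx+\frac{4r\left(c_\nu^2(m)+(m-1)(\lambda-\lambda^2)\right)}{(1-\nu^2m^2)\,\delta_0^m}\int_a^b\frac{|g(x)|^p}{\delta(x)^{2-m}}\,dx\le p^r\left(\frac{2}{1-\nu m}-\frac{4\lambda^2}{1-\nu^2m^2}\right)^r\int_a^b\frac{|g(x)|^{p-r}|g'(x)|^r}{\delta(x)^{2-r}}\,dx.$$ Here $c_\nu(m)$ (which depends on $\lambda$) is the number satisfying $$(1-2\lambda)J_\nu\left(\tfrac{2}{m}c_\nu(m)\right)+2c_\nu(m)J_\nu'\left(\tfrac{2}{m}c_\nu(m)\right)=0\quad\text{and}\quad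 \tfrac{2}{m}c_\nu(m)\in(0,j_\nu).$$
   Context: $J_\nu$ is the Bessel function of the first kind of order $\nu$, $J_\nu'$ its derivative, and $j_\nu$ the first positive zero of $J_\nu$; $c_\nu(m)$ is taken to be the first such root. *)

(* Defs.v *)
From HB Require Import structures.
From mathcomp Require Import all_boot all_order all_algebra.
From mathcomp Require Import all_classical all_reals all_analysis.

Set Implicit Arguments.
Unset Strict Implicit.
Unset Printing Implicit Defensive.

Import Order.TTheory GRing.Theory Num.Theory.
Import numFieldNormedType.Exports.

Local Open Scope classical_set_scope.
Local Open Scope ring_scope.

Definition Gamma (R : realType) (x : R) : R :=
  (\int[lebesgue_measure]_(t in `]0%R, +oo[) (t `^ (x - 1) * expR (- t)))%R.

(* Meant for 0 < x only: [powR] is not the usual power at negative bases. *)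
Definition besselJ (R : realType) (nu x : R) : R :=
  limn (series (fun k : nat =>
    (-1) ^+ k / (k`!%:R * Gamma (k%:R + nu + 1)) * (x / 2) `^ (2 * k%:R + nu))).

Definition is_first_bessel_zero (R : realType) (nu j : R) : Prop :=
  [/\ 0 < j, besselJ nu j = 0 & forall x, 0 < x < j -> besselJ nu x <> 0].

(* The default value 0 of [xget] is only returned when no such number exists,
   which does not happen for 0 <= nu; similarly in [bessel_c], where it does
   not happen for 0 < m, 0 <= nu and lambda < (1 + nu * m) / 2. *)
Definition bessel_zero (R : realType) (nu : R) : R :=
  xget 0 [set j | is_first_bessel_zero nu j].

Definition is_bessel_c_root (R : realType) (nu m lambda c : R) : Prop :=
  0 < 2 / m * c < bessel_zero nu /\
  (1 - 2 * lambda) * besselJ nu (2 / m * c)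
    + 2 * c * derive1 (besselJ nu) (2 / m * c) = 0.

Definition bessel_c (R : realType) (nu m lambda : R) : R :=
  xget 0 [set c | is_bessel_c_root nu m lambda c /\
                  forall c', is_bessel_c_root nu m lambda c' -> c <= c'].

(* The open intervals ]u i, v i[ may be empty; such terms contribute 0. *)
Definition abs_continuous (R : realType) (a b : R) (f : R -> R) : Prop :=
  forall e : R, 0 < e -> exists2 d : R, 0 < d &
    forall (n : nat) (u v : 'I_n -> R),
      (forall i, a <= u i /\ u i <= v i /\ v i <= b) ->
      trivIset setT (fun i => `]u i, v i[%classic) ->
      \sum_(i < n) (v i - u i) < d ->
      \sum_(i < n) `|f (v i) - f (u i)| < e.

Definition bdist (R : realType) (a b x : R) : R := Num.min (b - x) (x - a).

(* Main.v *)
Require Import Defs.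
From HB Require Import structures.
From mathcomp Require Import all_boot all_order all_algebra.
From mathcomp Require Import all_classical all_reals all_analysis.
From mathcomp Require Import measurable_realfun ring lra.

Set Implicit Arguments.
Unset Strict Implicit.
Unset Printing Implicit Defensive.

Import Order.TTheory GRing.Theory Num.Theory.
Import numFieldNormedType.Exports.

Local Open Scope classical_set_scope.
Local Open Scope ring_scope.

(** The inequality is proved first for [r = 1], where it concerns only
    [f = |g| `^ p]: with [delta0 = (b - a) / 2] and a weight
    [w = kappa / delta ^+ 2 + gam / delta0 `^ m * delta `^ (m - 2)], one wants
    the integral of [f * w] to be at most [A] times that of [|f'| / delta].
    Let [W] be the antiderivative of [- w] that vanishes at the midpoint.
    Since [f] vanishes at both ends, integrating [(f * W)' = f' * W - f * w]
    turns the left side into the integral of [f' * W], so it is enough that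
    [|W| <= A / delta].  After scaling [delta] to [s] in [0, 1] this reads
    [kappa (1 - s) + gam (s - s `^ m) / (m - 1) <= A].

    For [r > 1], Bernoulli's inequality [r y <= y `^ r + r - 1] at
    [y = p A |g'| delta / |g|] bounds [r] times the integrand [A |f'| / delta]
    pointwise by the integrand on the right of the theorem, constant included,
    plus [(r - 1) f / delta ^+ 2], and the last term is moved to the left side
    ([pointwise_hardy], [hardy_inequality]).  Part (i) is the
    case [kappa = 1 - nu ^+ 2 * m ^+ 2] with
    [gam = 4 (c ^+ 2 + (m - 1) (lambda - lambda ^+ 2))] and
    [A = 2 (1 + nu m) - 4 lambda ^+ 2], and part (ii) is the same choice of
    constants divided by that [kappa].

    It remains to verify the scalar inequality in [s], that is, to bound [c_nu(m)]
    from above.  With [alpha = (1 + nu m) / 2] the bound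
    [c ^+ 2 <= m (1 + nu) (alpha - lambda)] suffices ([weight_bound]); there
    it reduces to [(m + 1) (s - s `^ m) <= m - 1].  The bound itself
    ([bessel_c_bound]) follows from the defining equation of [c] once
    [J_nu <= 2 (nu + 1) / y * J_(nu + 1)] is known before the first zero of
    [J_nu]; by the contiguous relation this says [J_(nu + 2) >= 0] there, and
    positivity passes from [J_nu] to [J_(nu + 1)] and then to [J_(nu + 2)]
    because [y `^ (nu + 1) * J_(nu + 1)] has derivative [y `^ (nu + 1) * J_nu].

    Two analytic points need care.  First, an absolutely continuous function has
    to be differentiable almost everywhere and to be the integral of its
    derivative ([abs_continuous_FTC]).  It is the difference of two nondecreasing
    absolutely continuous functions, obtained from its total variation; the
    Stieltjes measure of each is dominated by Lebesgue measure, so the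
    Radon-Nikodym and Lebesgue differentiation theorems apply.  Second, to
    integrate [(f * W)'] and to subtract integrals that might be infinite, [|g|]
    is replaced by [max (|g| - eta) 0], which vanishes near [a] and [b]; this
    decreases the right side, and [eta] tends to 0 by monotone convergence. *)

(** * Absolutely continuous functions and total variation *)

Lemma abs_continuous_fin (R : realType) (a b : R) (f : R -> R) (e : R) :
  abs_continuous a b f -> 0 < e -> exists2 d : R, 0 < d &
    forall (I : finType) (u v : I -> R),
      (forall i, a <= u i /\ u i <= v i /\ v i <= b) ->
      trivIset setT (fun i => `]u i, v i[%classic) ->
      \sum_i (v i - u i) < d ->
      \sum_i `|f (v i) - f (u i)| < e.
Proof.
move=> acf e0; have [d d0 H] := acf e e0; exists d => // I u v uv tuv.
rewrite [X in X < d](reindex_omap enum_val (fun i => Some (enum_rank i)))/=; last first.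
  by move=> i _; rewrite enum_rankK.
rewrite [X in X < e](reindex_omap enum_val (fun i => Some (enum_rank i)))/=; last first.
  by move=> i _; rewrite enum_rankK.
under eq_bigl do rewrite enum_valK eqxx.
under [X in X < e]eq_bigl do rewrite enum_valK eqxx.
apply: H => // i j _ _ ij; apply/enum_val_inj/tuv => //.
Qed.

Lemma itv_partition_bounds (R : realType) (u v : R) (s : seq R) (k : nat) :
  itv_partition u v s -> (k <= size s)%N -> u <= nth v (u :: s) k <= v.
Proof.
move=> us ks; apply/andP; split.
  exact: (itv_partition_nth_ge _ us).
exact: (itv_partition_nth_le _ us).
Qed.

Lemma itv_partition_nth_homo (R : realType) (u v : R) (s : seq R) (k l : nat) :
  itv_partition u v s -> (l <= size s)%N -> (k < l)%N ->
  nth v (u :: s) k < nth v (u :: s) l.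
Proof.
move=> [us _] ls kl.
have := @sorted_ltn_nth _ <%O (@lt_trans _ R) v (u :: s) us k l.
by rewrite !inE /=; apply => //; rewrite ltnS // (leq_trans _ ls)// ltnW.
Qed.

(** An absolutely continuous function controls the total of its variations
   over disjoint intervals, because the partition points of all the intervals
   form one family of disjoint intervals of the same total length. *)
Lemma abs_continuous_variation (R : realType) (a b : R) (f : R -> R) (e : R) :
  abs_continuous a b f -> 0 < e -> exists2 d : R, 0 < d &
    forall (I : finType) (u v : I -> R) (s : I -> seq R),
      (forall i, a <= u i /\ v i <= b) ->
      trivIset setT (fun i => `]u i, v i[%classic) ->
      (forall i, itv_partition (u i) (v i) (s i)) ->
      \sum_i (v i - u i) < d ->
      \sum_i variation (u i) (v i) f (s i) < e.
Proof.
move=> acf e0; have [d d0 H] := abs_continuous_fin acf e0.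
exists d => // I u v s uv tuv ps sd.
pose J := {i : I & 'I_(size (s i))}.
pose x (j : J) := nth (v (tag j)) (u (tag j) :: s (tag j)) (tagged j).
pose y (j : J) := nth (v (tag j)) (u (tag j) :: s (tag j)) (tagged j).+1.
have xy j : x j < y j.
  by apply: (itv_partition_nth_homo (ps (tag j))) => //; exact: ltn_ord.
have xb j : u (tag j) <= x j.
  by have /andP[] := itv_partition_bounds (ps (tag j)) (ltnW (ltn_ord (tagged j))).
have yb j : y j <= v (tag j).
  by have /andP[] := itv_partition_bounds (ps (tag j)) (ltn_ord (tagged j)).
have -> : \sum_i variation (u i) (v i) f (s i) = \sum_(j : J) `|f (y j) - f (x j)|.
  rewrite (eq_bigr (fun i => \sum_(k < size (s i)) `|f (nth (v i) (u i :: s i) k.+1)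
     - f (nth (v i) (u i :: s i) k)|)); last first.
    by move=> i _; rewrite /variation big_mkord.
  rewrite (sig_big_dep xpredT (fun _ => xpredT)
    (fun i (k : 'I_(size (s i))) => `|f (nth (v i) (u i :: s i) k.+1)
     - f (nth (v i) (u i :: s i) k)|))/=.
  by apply: eq_bigr => -[i k] _.
apply: H.
- move=> j; have [? ?] := uv (tag j); split; first exact: le_trans (xb j).
  by split; [exact/ltW|exact: le_trans (yb j) _].
- move=> [i k] [i' k'] _ _ [z []] /=; rewrite !in_itv/= => /andP[z1 z2] /andP[z3 z4].
  have ii' : i = i'.
    apply: tuv => //; exists z; split; rewrite /= in_itv/=; apply/andP; split.
    + exact: le_lt_trans (xb (existT _ i k)) z1.
    + exact: lt_le_trans z2 (yb (existT _ i k)).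
    + exact: le_lt_trans (xb (existT _ i' k')) z3.
    + exact: lt_le_trans z4 (yb (existT _ i' k')).
  subst i'; congr existT; apply/val_inj => /=.
  have mono (p q : 'I_(size (s i))) : (p < q)%N ->
      nth (v i) (u i :: s i) p.+1 <= nth (v i) (u i :: s i) q.
    rewrite leq_eqVlt => /predU1P[-> //|pq].
    by apply/ltW/(itv_partition_nth_homo (ps i)) => //; exact: ltnW.
  have [kk'|kk'|//] := ltngtP k k'.
  + have := mono _ _ kk'; rewrite leNgt => /negP; case.
    exact: lt_trans z3 z2.
  + have := mono _ _ kk'; rewrite leNgt => /negP; case.
    exact: lt_trans z1 z4.
- apply: le_lt_trans sd.
  rewrite [leRHS](eq_bigr (fun i => \sum_(k < size (s i)) (nth (v i) (u i :: s i) k.+1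
     - nth (v i) (u i :: s i) k))); last first.
    move=> i _; rewrite -(big_mkord xpredT (fun k => nth (v i) (u i :: s i) k.+1
     - nth (v i) (u i :: s i) k)) telescope_sumr//; congr (_ - _).
    by rewrite (itv_partition_nth_size _ (ps i)).
  rewrite (sig_big_dep xpredT (fun _ => xpredT)
    (fun i (k : 'I_(size (s i))) => (nth (v i) (u i :: s i) k.+1
     - (nth (v i) (u i :: s i) k))))/=.
  by apply: ler_sum => -[i k] _.
Qed.

Lemma abs_continuous_id (R : realType) (a b : R) : abs_continuous a b id.
Proof.
move=> e e0; exists e => // n u v uv _ h; apply: le_lt_trans h.
by apply: ler_sum => i _; rewrite ger0_norm// subr_ge0; have [_ []] := uv i.
Qed.

Lemma abs_continuous_dominated (R : realType) (a b K : R) (f g h : R -> R) :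
  0 <= K -> abs_continuous a b f -> abs_continuous a b g ->
  (forall x y, a <= x -> x <= y -> y <= b ->
    `|h y - h x| <= K * (`|f y - f x| + `|g y - g x|)) ->
  abs_continuous a b h.
Proof.
move=> K0 acf acg hfg e e0.
have e'0 : 0 < e / (2 * (K + 1)) by rewrite divr_gt0// mulr_gt0//; lra.
have [d1 d10 H1] := acf _ e'0; have [d2 d20 H2] := acg _ e'0.
exists (Num.min d1 d2); first by rewrite lt_min d10.
move=> n u v uv tuv; rewrite lt_min => /andP[uvd1 uvd2].
have {}H1 := H1 n u v uv tuv uvd1; have {}H2 := H2 n u v uv tuv uvd2.
apply: (@le_lt_trans _ _ (K * (\sum_(i < n) `|f (v i) - f (u i)| +
   \sum_(i < n) `|g (v i) - g (u i)|))).
  rewrite -big_split/= mulr_sumr; apply: ler_sum => i _.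
  by have [? [? ?]] := uv i; exact: hfg.
apply: (@le_lt_trans _ _ (K * (e / (2 * (K + 1)) + e / (2 * (K + 1))))).
  by apply: ler_wpM2l => //; apply: lerD; exact: ltW.
have -> : K * (e / (2 * (K + 1)) + e / (2 * (K + 1))) = e * (K / (K + 1)).
  by field; rewrite gt_eqF//; lra.
by rewrite -[ltRHS]mulr1 ltr_pM2l// ltr_pdivrMr; lra.
Qed.

(** Composition with [clip a b] extends a function on [a, b] to the line by
    constants, and keeps absolute continuity on every interval. *)
Definition clip (R : realType) (a b x : R) : R := Num.min b (Num.max a x).

Lemma clip_homo (R : realType) (a b x y : R) : x <= y -> clip a b x <= clip a b y.
Proof.
move=> xy; rewrite /clip le_min ge_min lexx/= ge_min ge_max; apply/orP.
by right; rewrite !le_max lexx xy orbT.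
Qed.

Lemma clip_ge (R : realType) (a b x : R) : a <= b -> a <= clip a b x.
Proof. by move=> ab; rewrite /clip le_min ab le_max lexx. Qed.

Lemma clip_le (R : realType) (a b x : R) : clip a b x <= b.
Proof. by rewrite /clip ge_min lexx. Qed.

Lemma clip_id (R : realType) (a b x : R) : a <= x <= b -> clip a b x = x.
Proof. by move=> /andP[ax xb]; rewrite /clip (max_idPr ax) (min_idPr xb). Qed.

Lemma clip_lipschitz (R : realType) (a b x y : R) : x <= y ->
  clip a b y - clip a b x <= y - x.
Proof. by rewrite /clip /Num.min /Num.max; do ! case: ifPn; rewrite -?leNgt; lra. Qed.

Lemma clip_sub_itv (R : realType) (a b x y : R) :
  `]clip a b x, clip a b y[%classic `<=` `]x, y[%classic.
Proof.
move=> z /=; rewrite !in_itv/= /clip.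
by rewrite /Num.min /Num.max; do ! case: ifPn; rewrite -?leNgt; lra.
Qed.

Lemma abs_continuous_clip (R : realType) (a b a' b' : R) (f : R -> R) : a <= b ->
  abs_continuous a b f -> abs_continuous a' b' (f \o clip a b).
Proof.
move=> ab acf e e0; have [d d0 H] := acf e e0; exists d => // n u v uv tuv uvd.
apply: (H n (clip a b \o u) (clip a b \o v)).
- move=> i /=; have [_ [? _]] := uv i.
  by rewrite clip_ge// clip_le; split => //; split => //; exact: clip_homo.
- by move=> i j _ _ [z [/clip_sub_itv zi /clip_sub_itv zj]]; apply: tuv => //; exists z.
- apply: le_lt_trans uvd; apply: ler_sum => i _ /=.
  by apply: clip_lipschitz; have [_ []] := uv i.
Qed.

(** Intervals shorter than the threshold for 1 have total variation at most 1,
    and finitely many of them cover [a, b]. *)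
Lemma abs_continuous_bounded_variation (R : realType) (a b : R) (f : R -> R) :
  a <= b -> abs_continuous a b f -> bounded_variation a b f.
Proof.
move=> ab acf.
have [d d0 H] := abs_continuous_variation acf ltr01.
have short u v : a <= u -> u <= v -> v <= b -> v - u < d -> bounded_variation u v f.
  move=> au uv vb uvd; exists 1 => _ [s us <-]; apply/ltW.
  have := H unit (fun=> u) (fun=> v) (fun=> s).
  by rewrite !(big_pred1 tt)//=; apply => //; case=> [] [].
have [n nd] : exists n : nat, (b - a) < n.+1%:R * (d / 2).
  exists (Num.truncn ((b - a) / (d / 2))).
  by rewrite -ltr_pdivrMr ?divr_gt0// truncnS_gt.
pose x (k : nat) := Num.min b (a + k%:R * (d / 2)).
have step k : bounded_variation a (x k) f.
  elim: k => [|k ih].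
    rewrite /x mul0r addr0 (min_idPr ab); exact: bounded_variationxx.
  have ax : a <= x k by rewrite le_min ab lerDl mulr_ge0// ltW// divr_gt0.
  have xS : x k <= x k.+1.
    rewrite /x /Num.min -(natr1 k).
    by do ! (case: ifPn; rewrite -?leNgt => ?); lra.
  have axS : a <= x k.+1 := le_trans ax xS.
  apply/bounded_variationP => //; rewrite (@total_variationD _ _ _ (x k))//.
  rewrite fin_numD; apply/andP; split; apply/bounded_variationP => //.
  apply: short => //; first by rewrite ge_min lexx.
  rewrite /x /Num.min -(natr1 k).
  by do ! (case: ifPn; rewrite -?leNgt => ?); lra.
have -> : b = x n.+1; last exact: step.
rewrite /x; apply/esym/min_idPl; lra.
Qed.

Lemma total_variationB (R : realType) (a b : R) (f : R -> R) (x y : R) :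
  bounded_variation a b f -> a <= x -> x <= y -> y <= b ->
  (fine (total_variation a y f) - fine (total_variation a x f))%:E
    = total_variation x y f.
Proof.
move=> bvf ax xy yb; have ay := le_trans ax xy.
have fx : total_variation a x f \is a fin_num.
  by apply/bounded_variationP => //; apply: bounded_variationl bvf => //; exact: le_trans yb.
have fxy : total_variation x y f \is a fin_num.
  apply/bounded_variationP => //; apply: (bounded_variationr ax xy).
  exact: bounded_variationl bvf.
by rewrite (total_variationD _ ax xy) fineD// addrAC subrr add0r fineK.
Qed.

(** The total variation over each interval of a small disjoint family is, up to an
    error that sums to at most [e / 2], the variation over a partition of it. *)
Lemma abs_continuous_total_variation (R : realType) (a b : R) (f : R -> R) :
  a <= b -> abs_continuous a b f ->
  abs_continuous a b (fun x => fine (total_variation a x f)).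
Proof.
move=> ab acf e e0.
have bvf := abs_continuous_bounded_variation ab acf.
have e2 : 0 < e / 2 by rewrite divr_gt0.
have [d d0 H] := abs_continuous_variation acf e2.
exists d => // n u v uv tuv uvd.
have eta0 : 0 < e / 2 / n.+1%:R by rewrite divr_gt0.
have /choice[s sP] : forall i : 'I_n, exists s, itv_partition (u i) (v i) s /\
   fine (total_variation a (v i) f) - fine (total_variation a (u i) f)
     <= variation (u i) (v i) f s + e / 2 / n.+1%:R.
  move=> i; have [au [uvi vb]] := uv i.
  have tvE := total_variationB bvf au uvi vb.
  have tvfin : total_variation (u i) (v i) f \is a fin_num by rewrite -tvE.
  have [_ [_ [s us <-] <-]] := ub_ereal_sup_adherent eta0 tvfin.
  rewrite -/(total_variation (u i) (v i) f) -tvE -EFinB lte_fin => h.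
  by exists s; split => //; rewrite -lerBlDr; exact: ltW h.
apply: (@le_lt_trans _ _ (\sum_(i < n) (variation (u i) (v i) f (s i) + e / 2 / n.+1%:R))).
  apply: ler_sum => i _; have [au [uvi vb]] := uv i.
  rewrite ger0_norm; first by have [] := sP i.
  by rewrite -lee_fin (total_variationB bvf)// total_variation_ge0.
rewrite big_split/= sumr_const card_ord.
have Hs := H _ u v s (fun i => conj (uv i).1 (uv i).2.2) tuv (fun i => (sP i).1) uvd.
rewrite [ltRHS]splitr; apply: ltr_leD => //.
by rewrite -[_ *+ n]mulr_natr -mulrA ger_pMr// ler_pdivrMl// mulr1 ler_nat.
Qed.

(** * The fundamental theorem of calculus for absolutely continuous functions *)

Lemma open_interval_ooE (R : realType) (l r : R) (J : set R) : l <= r ->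
  open J -> is_interval J -> J `<=` `]l, r[ ->
  exists u v, [/\ l <= u, u <= v, v <= r & J = `]u, v[%classic].
Proof.
move=> lr oJ iJ Jlr; have [->|J0] := eqVneq J set0.
  by exists l, l; split => //; rewrite set_itvoo0.
have [x Jx] : J !=set0 by exact/set0P.
have lb : lbound J l by move=> z /Jlr /=; rewrite in_itv/= => /andP[/ltW].
have ub : ubound J r by move=> z /Jlr /=; rewrite in_itv/= => /andP[_ /ltW].
have hl : has_lbound J by exists l.
have hu : has_ubound J by exists r.
exists (inf J), (sup J); split.
- by apply: lb_le_inf => //; exists x.
- by apply: (@le_trans _ _ x); [exact: ge_inf|exact: ub_le_sup].
- by apply: ge_sup => //; exists x.
- by rewrite set_itvoo -interval_bounded_interior//; apply/esym/interior_id.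
Qed.

Lemma abs_continuous_cvg (R : realType) (a b : R) (f : R -> R) (x : R) :
  abs_continuous a b f -> a < x < b -> {for x, continuous f}.
Proof.
move=> acf /andP[ax xb]; apply/cvgrPdist_lt => e e0.
have [d d0 H] := acf e e0.
have two u v : a <= u -> u <= v -> v <= b -> v - u < d -> `|f v - f u| < e.
  move=> au uv vb uvd; have := H 1%N (fun=> u) (fun=> v).
  rewrite !big_ord_recl !big_ord0 !addr0; apply => //.
  by move=> i j; rewrite (ord1 i) (ord1 j).
near=> y.
have yd : `|x - y| < d by near: y; exists d.
have ay : a < y by near: y; exact: lt_nbhsr.
have yb : y < b by near: y; exact: lt_nbhsl.
have [xy|yx] := leP x y.
- by rewrite distrC; apply: two; rewrite ?(ltW ax) ?(ltW yb)//;
    apply: le_lt_trans yd; rewrite distrC ler_norm.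
- by apply: two; rewrite ?(ltW ay) ?(ltW xb) ?(ltW yx)//;
    apply: le_lt_trans yd; rewrite ler_norm.
Unshelve. all: by end_near. Qed.

Lemma clip_nondecreasing (R : realType) (a b : R) (f : R -> R) : a <= b ->
  {in `[a, b] &, nondecreasing_fun f} -> nondecreasing_fun (f \o clip a b).
Proof.
move=> ab ndf x y xy /=; apply: ndf; rewrite ?in_itv/= ?clip_ge ?clip_le//.
exact: clip_homo.
Qed.

Lemma clip_right_continuous (R : realType) (a b : R) (f : R -> R) : a <= b ->
  abs_continuous a b f -> right_continuous (f \o clip a b).
Proof.
move=> ab acf; apply: right_continuousW => x.
apply: (@abs_continuous_cvg _ (x - 1) (x + 1)); first exact: abs_continuous_clip.
by rewrite ltrBlDr ltrDl ltr01.
Qed.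

Lemma lebesgue_stieltjes_measure_oc (R : realType) (F : cumulative R R) (u v : R) :
  u <= v -> lebesgue_stieltjes_measure F `]u, v]%classic = (F v - F u)%:E.
Proof.
move=> uv; rewrite /lebesgue_stieltjes_measure /measure_extension.
by rewrite measurable_mu_extE/= ?wlength_itv_bnd//; exact: is_ocitv.
Qed.

(** Cover a null set by an open set of small measure; its components are
    disjoint intervals, over which absolute continuity bounds the total
    increment, that is, the Stieltjes measure. *)
Lemma lebesgue_stieltjes_dominated (R : realType) (a b : R) (F : cumulative R R)
    (N : set R) :
  a < b -> abs_continuous a b F -> N `<=` `]a, b[ -> measurable N ->
  lebesgue_measure N = 0%E -> lebesgue_stieltjes_measure F N = 0%E.
Proof.
move=> ab acF Nab mN N0.
apply/eqP; rewrite eq_le measure_ge0 andbT; apply/lee_addgt0Pr => e e0.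
rewrite add0e; have [d d0 H] := acF e e0.
have [U0 [oU0 NU0 U0d]] : exists U : set R, [/\ open U, N `<=` U &
    (lebesgue_measure (U `\` N) < d%:E)%E].
    by apply: lebesgue_regularity_outer => //; rewrite [ltLHS]N0 ltry.
pose U := U0 `&` `]a, b[%classic.
have oU : open U by apply: openI => //; exact: interval_open.
have NU : N `<=` U by move=> x Nx; split; [exact: NU0|exact: Nab].
have mU : measurable U by exact: measurable_realfun.open_measurable.
have mU0 : measurable U0 by exact: measurable_realfun.open_measurable.
have Ud : (lebesgue_measure U < d%:E)%E.
  apply: le_lt_trans U0d; rewrite -[leRHS]add0e -N0 -measureU//.
  - by apply: le_measure; rewrite ?inE//; [apply: measurableU => //; exact: measurableD|
      move=> x [? _]; have [?|?] := pselect (N x); [left|right]].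
  - exact: measurableD.
  - by apply/seteqP; split => // x [? []].
pose J := open_disjoint_itv oU.
have mJ k : measurable (J k).
  by apply: measurable_realfun.open_measurable; exact: open_disjoint_itv_open.
have tJ : trivIset setT J by exact: open_disjoint_itv_trivIset.
have UJ : U = \bigcup_k J k by exact: open_disjoint_itv_bigcup.
have /choice[uv uvP] : forall k, exists p : R * R,
    [/\ a <= p.1, p.1 <= p.2, p.2 <= b & J k = `]p.1, p.2[%classic].
  move=> k; have [|||u [v [? ? ? ?]]] := @open_interval_ooE R a b (J k) (ltW ab).
  - exact: open_disjoint_itv_open.
  - exact: open_disjoint_itv_is_interval.
  - apply: (@subset_trans _ U); last by move=> x [].
    by rewrite UJ; exact: bigcup_sup.
  by exists (u, v).
apply: (@le_trans _ _ (lebesgue_stieltjes_measure F U)).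
  by apply: le_measure; rewrite ?inE.
rewrite UJ measure_bigcup//; last by move=> k _; exact: mJ.
apply: lime_le; first exact: is_cvg_nneseries.
near=> n; apply: (@le_trans _ _ (\sum_(0 <= k < n) (F (uv k).2 - F (uv k).1)%:E)%E).
  rewrite big_mkcond/=; apply: lee_sum => k _.
  have [au uvk vb JE] := uvP k.
  case: ifPn => _; last by rewrite lee_fin subr_ge0 (cumulative_is_nondecreasing F).
  rewrite -lebesgue_stieltjes_measure_oc// JE.
  by apply: le_measure; rewrite ?inE//; apply: subset_itvl; rewrite bnd_simp.
rewrite sumEFin lee_fin big_mkord; 
apply: (@le_trans _ _ (\sum_(i < n) `|F (uv i).2 - F (uv i).1|)).
  by apply: ler_sum => i _; exact: ler_norm.
apply/ltW/(H n (fun i => (uv i).1) (fun i => (uv i).2)).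
- by move=> i; have [] := uvP i.
- move=> i j _ _ [z [zi zj]]; apply/val_inj; apply: tJ => //; exists z.
  by have [_ _ _ ->] := uvP i; have [_ _ _ ->] := uvP j.
- rewrite -lte_fin; apply: le_lt_trans Ud.
  rewrite -sumEFin UJ measure_bigcup//; last by move=> k _; exact: mJ.
  apply: le_trans (nneseries_lim_ge n _) => //.
  rewrite [leRHS]big_mkcond [leRHS]big_mkord/=; apply: lee_sum => i _.
  rewrite in_setT; have [_ uvi _ ->] := uvP i; rewrite lebesgue_measure_itv/= lte_fin.
  by case: ltP => // vu; rewrite lee_fin subr_le0.
Unshelve. all: by end_near. Qed.

Lemma nondecreasing_abs_continuous_density (R : realType) (a b : R) (F : R -> R) :
  a < b -> {in `[a, b] &, nondecreasing_fun F} -> abs_continuous a b F ->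
  exists h : R -> R,
    lebesgue_measure.-integrable setT (EFin \o h) /\
    forall x, a <= x <= b ->
      (F x - F a)%:E = (\int[lebesgue_measure]_(t in `]a, x]) (h t)%:E)%E.
Proof.
move=> ab ndF acF; have ab' := ltW ab.
pose isC := @isCumulative.Build R _ R (F \o clip a b)
  (clip_nondecreasing ab' ndF) (clip_right_continuous ab' acF).
pose C : cumulative R R := HB.pack (F \o clip a b) isC.
have CE x : a <= x <= b -> C x = F x by move=> xab; rewrite /C/= clip_id.
pose nu0 := lebesgue_stieltjes_measure C.
have mab : measurable (`]a, b]%classic : set (measurableTypeR R)) by exact: measurable_itv.
have nuab : (nu0 `]a, b]%classic < +oo)%E.
  by rewrite /nu0 lebesgue_stieltjes_measure_oc// ltry.
pose nu : {finite_measure set (measurableTypeR R) -> \bar R} := mfrestr mab nuab.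
have numu : nu `<< (@lebesgue_measure R).
  apply/null_content_dominatesP => A mA A0; rewrite /nu /= /mfrestr /mrestr.
  (* the margin of 1 makes the endpoint [b] an interior point *)
  apply: (@lebesgue_stieltjes_dominated R (a - 1) (b + 1) C).
  - by rewrite ltrBlDr (lt_trans ab)// -addrA ltrDl; rewrite addr_gt0.
  - by apply: abs_continuous_clip.
  - move=> x [_] /=; rewrite !in_itv/= => /andP[ax xb]; apply/andP; split; lra.
  - exact: measurableI.
  - apply/eqP; rewrite eq_le measure_ge0 andbT -A0.
    by apply: le_measure; rewrite ?inE//; exact: measurableI.
have [f [f0 ffin fint fE]] := radon_nikodym_sigma_finite numu.
exists (fine \o f); split.
  apply: eq_integrable fint => // x _ /=; by rewrite fineK.
move=> x /andP[ax xb].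
under eq_integral do rewrite /= fineK//.
rewrite -fE//.
rewrite /nu /= /mfrestr /mrestr setIidl; last first.
  by apply: subset_itvl; rewrite bnd_simp.
rewrite lebesgue_stieltjes_measure_oc// !CE ?ax ?xb ?lexx//.
Qed.

(** The Lebesgue fundamental theorem of calculus.  The function is the
    difference of its total variation and of a second nondecreasing function;
    each has a density by the Radon-Nikodym theorem, and Lebesgue's
    differentiation theorem identifies the derivative with the density. *)
Lemma abs_continuous_FTC (R : realType) (a b : R) (f : R -> R) :
  a < b -> abs_continuous a b f ->
  exists h : R -> R,
    [/\ lebesgue_measure.-integrable setT (EFin \o h),
      (f b - f a)%:E = (\int[lebesgue_measure]_(t in `]a, b]) (h t)%:E)%E &
      {ae lebesgue_measure, forall x, a < x < b -> derivable f x 1 /\ derive1 f x = h x}].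
Proof.
move=> ab acf; have ab' := ltW ab.
have bvf := abs_continuous_bounded_variation ab' acf.
pose V x := fine (total_variation a x f).
have VB x y : a <= x -> x <= y -> y <= b -> `|f y - f x| <= V y - V x.
  move=> ax xy yb; rewrite -lee_fin (total_variationB bvf)//.
  exact: total_variation_ge.
have acV : abs_continuous a b V by exact: abs_continuous_total_variation.
have acW : abs_continuous a b (fun x => V x - f x).
  apply: (abs_continuous_dominated ler01 acV acf) => x y ax xy yb.
  rewrite mul1r (_ : V y - f y - (V x - f x) = (V y - V x) - (f y - f x)); last by ring.
  exact: ler_normB.
have [|h1 [ih1 h1E]] := nondecreasing_abs_continuous_density ab _ acV.
  move=> x y; rewrite !in_itv/= => /andP[ax xb] /andP[ay yb] xy.
  by rewrite -subr_ge0 (le_trans _ (VB _ _ _ _ _)).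
have [|h2 [ih2 h2E]] := nondecreasing_abs_continuous_density ab _ acW.
  move=> x y; rewrite !in_itv/= => /andP[ax xb] /andP[ay yb] xy.
  have := le_trans (ler_norm _) (VB _ _ ax xy yb); lra.
(* [f] is [V] minus [V - f] *)
exists (h1 \- h2).
have ih : lebesgue_measure.-integrable setT (EFin \o (h1 \- h2)).
  apply: eq_integrable (integrableB _ ih1 ih2) => //.
have fE x : a <= x <= b ->
    (f x - f a)%:E = (\int[lebesgue_measure]_(t in `]a, x]) ((h1 \- h2) t)%:E)%E.
  move=> xab; under eq_integral do rewrite EFinB.
  rewrite integralB//=; last 2 first.
  - by apply: integrableS ih1.
  - by apply: integrableS ih2.
  by rewrite -h1E// -h2E// -EFinB; congr EFin; ring.
split => //; first by rewrite -fE// lexx ltW.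
have := @FTC1 R (h1 \- h2) (BRight a); cbv zeta.
set I := (fun x => Rintegral _ _ _); move=> H.
have {H} : {ae lebesgue_measure, forall x, a < x ->
    derivable I x 1 /\ derive1 I x = (h1 \- h2) x}.
  apply: (@filterS _ _ (ae_filter_ringOfSetsType lebesgue_measure) _ _ _ (H _ _)) => [x|y|].
  - by rewrite /= lte_fin.
  - by apply: integrableS ih.
  - by apply: open_integrable_locally => //; exact: openT.
apply: (@filterS _ _ (ae_filter_ringOfSetsType lebesgue_measure)) => x H /andP[ax xb].
have [dI I'] := H ax.
have near_eq : {near x, f =1 (fun x => I x + f a)}.
  near=> y.
  have ay : a < y by near: y; exact: lt_nbhsr.
  have yb : y < b by near: y; exact: lt_nbhsl.
  by rewrite /I /Rintegral -fE ?(ltW ay) ?(ltW yb)//= subrK.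
have dIf : is_derive x 1 (fun x => I x + f a) ((h1 \- h2) x).
  rewrite -I' derive1E -[X in is_derive _ _ _ X]addr0; apply: is_deriveD.
  exact/derivableP.
have [df f'] : is_derive x 1 f ((h1 \- h2) x).
  by apply: near_eq_is_derive dIf; apply: filterS near_eq => y ->.
by split => //; rewrite derive1E.
Unshelve. all: by end_near. Qed.

(** * The recurrence of the Gamma function *)

(** Only one-sided at 0: [powR] is 1 at negative bases. *)
Lemma powR_within_continuous (R : realType) (p n : R) : 0 <= p -> 0 < n ->
  {within `[0, n], continuous (fun t : R => t `^ p)}.
Proof.
rewrite le_eqVlt => /predU1P[<- _|p0 n0].
  rewrite (_ : (fun t : R => t `^ 0) = cst 1); first exact: cst_continuous.
  by apply/funext => t; rewrite powRr0.
have dp x : 0 < x -> {for x, continuous (fun t : R => t `^ p)}.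
  move=> x0; apply/differentiable_continuous/derivable1_diffP.
  by have [] := is_derive1_powR p x0.
apply/continuous_within_itvP => //; split.
- by move=> x; rewrite in_itv/= => /andP[x0 _]; exact: dp.
- by rewrite powR0 ?gt_eqF//; exact: powR_cvg0.
- by apply: cvg_at_left_filter; exact: dp.
Qed.

(** Euler's integral as an extended real; it makes the recurrence available
    before finiteness is known. *)
Definition eGamma (R : realType) (x : R) : \bar R :=
  (\int[lebesgue_measure]_(t in `]0%R, +oo[) (t `^ (x - 1) * expR (- t))%:E)%E.

Lemma measurable_expRN (R : realType) (D : set R) :
  measurable_fun D (fun t : R => expR (- t)).
Proof. by apply: measurableT_comp. Qed.

Lemma measurable_Gamma_integrand (R : realType) (x : R) (D : set R) :
  measurable_fun D (fun t : R => t `^ x * expR (- t)).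
Proof.
apply: measurable_funM; first exact: measurable_funTS (measurable_powR _).
apply: measurableT_comp => //.
Qed.

Lemma Gamma_integrand_cvg (R : realType) (x : R) : 1 <= x ->
  (\int[lebesgue_measure]_(t in `[0%R, n.+1%:R]) (t `^ (x - 1) * expR (- t))%:E)%E
    @[n --> \oo] --> eGamma x.
Proof.
move=> x1; pose f (t : R) := (t `^ (x - 1) * expR (- t))%:E.
have -> : eGamma x = (\int[lebesgue_measure]_(t in \bigcup_n `]0%R, n.+1%:R]%classic) f t)%E.
  congr (integral _ _ _); rewrite itv_bndy_bigcup_BRight.
  rewrite eqEsubset; split => t [n _ /=]; rewrite !in_itv/= => /andP[t0 tn].
    by exists n => //=; rewrite in_itv/= t0 (le_trans tn)// add0r ler_nat.
  by exists n.+1 => //=; rewrite in_itv/= t0 add0r.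
rewrite (_ : (fun n => _) =
    (fun n : nat => (\int[lebesgue_measure]_(t in `]0%R, n.+1%:R]) f t)%E)); last first.
  apply/funext => n; rewrite integral_itv_obnd_cbnd//.
  by apply/measurable_EFinP; exact: measurable_Gamma_integrand.
apply: ge0_nondecreasing_set_cvg_integral.
- move=> m n mn; apply/subsetPset => t /=; rewrite !in_itv/= => /andP[-> /le_trans]; apply.
  by rewrite ler_nat.
- by move=> n; exact: measurable_itv.
- by move=> n; apply/measurable_EFinP; exact: measurable_Gamma_integrand.
- by move=> n t _; rewrite lee_fin mulr_ge0// ?powR_ge0// expR_ge0.
Qed.

Lemma powR_expR_cvg0 (R : realType) (x : R) : 0 <= x ->
  (n.+1%:R : R) `^ x * expR (- n.+1%:R) @[n --> \oo] --> (0 : R).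
Proof.
move=> x0; pose N := (Num.truncn x).+1.
apply: (@squeeze_cvgr _ _ _ _ (fun=> 0) (fun n => N.+1`!%:R * harmonic n)).
- apply: nearW => n; rewrite mulr_ge0 ?powR_ge0 ?expR_ge0//=.
  have n0 : (0 : R) < n.+1%:R by [].
  have xN : (n.+1%:R : R) `^ x <= n.+1%:R ^+ N.
    by rewrite -powR_mulrn// ler_powR ?ler1n// ltW// truncnS_gt.
  have eN : (n.+1%:R : R) ^+ N.+1 / N.+1`!%:R <= expR n.+1%:R.
    by rewrite (le_trans _ (expR_ge1Dxn N (ltW n0)))// lerDr.
  rewrite expRN; have f0 : (0 : R) < N.+1`!%:R by rewrite ltr0n fact_gt0.
  rewrite ler_pdivrMr ?expR_gt0// (le_trans xN)//.
  rewrite -[leLHS](mulKf (lt0r_neq0 n0)) -exprS mulrAC mulrC ler_pM2r ?invr_gt0//.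
  by rewrite mulrC -ler_pdivrMr.
- exact: cvg_cst.
- by rewrite -[X in _ --> X](mulr0 (N.+1`!%:R)); apply: cvgMr; exact: cvg_harmonic.
Qed.

Lemma eGamma_parts (R : realType) (x n : R) : 1 <= x -> 0 < n ->
  (\int[lebesgue_measure]_(t in `[0%R, n]) (t `^ x * expR (- t))%:E =
   x%:E * \int[lebesgue_measure]_(t in `[0%R, n]) (t `^ (x - 1) * expR (- t))%:E
     - (n `^ x * expR (- n))%:E)%E.
Proof.
move=> x1 n0; have x0 : 0 < x by rewrite (lt_le_trans ltr01).
have cexp : continuous (fun t : R => expR (- t)).
  by move=> t; apply: continuous_comp; [exact: opp_continuous|exact: continuous_expR].
have dG (t : R) : is_derive t 1 (fun t : R => - expR (- t)) (expR (- t)).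
  by apply: is_derive_eq; rewrite mulrN1 opprK.
have cG : continuous (fun t : R => - expR (- t)).
  by move=> t; apply: cvgN; exact: cexp.
have cx1 : {within `[0, n], continuous (fun t => t `^ (x - 1))}.
  by apply: powR_within_continuous; rewrite // subr_ge0.
have := @integration_by_parts R (fun t => t `^ x) (fun t => - expR (- t))
  (fun t => x * t `^ (x - 1)) (fun t => expR (- t)) 0 n n0.
move=> ->; last 6 first.
- by move=> t; apply: cvgMr; exact: cx1.
- split.
  + move=> t; rewrite in_itv/= => /andP[t0 _]; by have [] := is_derive1_powR x t0.
  + by have /continuous_within_itvP[] := powR_within_continuous (ltW x0) n0.
  + by have /continuous_within_itvP[] := powR_within_continuous (ltW x0) n0.
- move=> t; rewrite in_itv/= => /andP[t0 _]; rewrite derive1E.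
  by have [_ ->] := is_derive1_powR x t0.
- by apply: continuous_subspaceT.
- split.
  + by move=> t _; have [] := dG t.
  + by apply: cvg_at_right_filter; exact: cG.
  + by apply: cvg_at_left_filter; exact: cG.
- by move=> t _; rewrite derive1E; have [_ ->] := dG t.
rewrite powR0 ?gt_eqF// mul0r subr0 mulrN addeC.
under eq_integral do rewrite -mulrA mulrN mulrN EFinN EFinM.
rewrite integralN/=; last first.
  rewrite fin_num_adde_defl// fin_numN integral0_eq// => t t0n.
  rewrite (@ge0_funenegE _ _ setT) ?inE// => s _.
  by rewrite mule_ge0// lee_fin ?(ltW x0)// mulr_ge0 ?powR_ge0 ?expR_ge0.
rewrite ge0_integralZl//=.
- by rewrite oppeK.
- by apply/measurable_EFinP; exact: measurable_Gamma_integrand.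
- by move=> t _; rewrite lee_fin mulr_ge0// ?powR_ge0// expR_ge0.
- by rewrite lee_fin ltW.
Qed.

(** Integration by parts on [0, n + 1]; both integrals increase to their limits
    and the boundary term tends to 0. *)
Lemma eGamma_recurrence (R : realType) (x : R) : 1 <= x ->
  eGamma (x + 1) = (x%:E * eGamma x)%E.
Proof.
move=> x1; have x0 : 0 < x by rewrite (lt_le_trans ltr01).
have := @Gamma_integrand_cvg R (x + 1); rewrite lerDr (ltW x0) addrK => /(_ isT) H1.
have H2 : (x%:E * \int[lebesgue_measure]_(t in `[0%R, n.+1%:R]) (t `^ (x - 1) * expR (- t))%:E
     - (n.+1%:R `^ x * expR (- n.+1%:R))%:E)%E @[n --> \oo] --> (x%:E * eGamma x - 0)%E.
  apply: cvgeB; first by rewrite fin_num_adde_defl.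
    by apply: cvgeZl => //; exact: Gamma_integrand_cvg.
  by apply: cvg_EFin; [exact: nearW|exact: powR_expR_cvg0 (ltW x0)].
rewrite sube0 in H2.
have H3 := cvg_unique _ H1; apply: H3 => //.
rewrite (_ : (fun n => _) = (fun n : nat =>
   (x%:E * \int[lebesgue_measure]_(t in `[0%R, n.+1%:R])
    (t `^ (x - 1) * expR (- t))%:E - (n.+1%:R `^ x * expR (- n.+1%:R))%:E)%E))//.
by apply/funext => n; rewrite eGamma_parts.
Qed.

Lemma integral_expRN (R : realType) (a : R) :
  (\int[lebesgue_measure]_(t in `[a, +oo[) (expR (- t))%:E = (expR (- a))%:E)%E.
Proof.
have cexp : continuous (fun t : R => expR (- t)).
  by move=> t; apply: continuous_comp; [exact: opp_continuous|exact: continuous_expR].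
have dG (t : R) : is_derive t 1 (fun t : R => - expR (- t)) (expR (- t)).
  by apply: is_derive_eq; rewrite mulrN1 opprK.
rewrite (@ge0_continuous_FTC2y R _ (fun t => - expR (- t)) a 0) ?oppr0.
- by rewrite sub0e EFinN oppeK.
- by move=> t _; exact: expR_ge0.
- exact: continuous_subspaceT.
- by rewrite -oppr0; apply: cvgN; exact: cvgr_expR.
- by move=> t _; have [] := dG t.
- by apply: cvg_at_right_filter; apply: cvgN; exact: cexp.
- by move=> t _; rewrite derive1E; have [_ ->] := dG t.
Qed.

Lemma eGamma1_lty (R : realType) : (eGamma (1 : R) < +oo)%E.
Proof.
rewrite /eGamma subrr; under eq_integral do rewrite powRr0 mul1r.
rewrite integral_itv_obnd_cbnd; first by rewrite integral_expRN ltry.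
by apply/measurable_EFinP; exact: measurable_expRN.
Qed.

(** On [1, 2] the integrand is below the sum of the integrands at 1 and 2, where
    finiteness follows from the recurrence. *)
Lemma eGamma_lty_lt2 (R : realType) (x : R) : 1 <= x <= 2 -> (eGamma x < +oo)%E.
Proof.
move=> /andP[x1 x2].
have E2 : (eGamma (2 : R) < +oo)%E.
  by rewrite (_ : 2 = 1 + 1)// eGamma_recurrence// mul1e eGamma1_lty.
apply: (@le_lt_trans _ _ (eGamma 1 + eGamma 2)%E);
  last exact: lte_add_pinfty (eGamma1_lty R) E2.
have m (D : set R) (y : R) : measurable_fun D (EFin \o (fun t : R => t `^ y * expR (- t))).
  by apply/measurable_EFinP; exact: measurable_Gamma_integrand.
have p0 (t y : R) : (0 <= (t `^ y * expR (- t))%:E)%E.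
  by rewrite lee_fin mulr_ge0// ?powR_ge0// expR_ge0.
rewrite /eGamma -ge0_integralD//; [|exact: m..].
apply: ge0_le_integral => //; [exact: m|by apply: emeasurable_funD; exact: m|].
move=> t /=; rewrite in_itv/= andbT => t0.
rewrite -EFinD lee_fin -mulrDl ler_pM2r ?expR_gt0// subrr powRr0.
have -> : (2 - 1 : R) = 1 by ring.
rewrite (powRr1 (ltW t0)); have [t1|t1] := leP 1 t.
  by rewrite (@le_trans _ _ t) ?lerDr ?ler01//; apply: ler1_powR => //; lra.
rewrite (@le_trans _ _ 1)// ?lerDl ?(ltW t0)//.
have : t `^ (x - 1) <= 1 `^ (x - 1).
  by apply: ge0_ler_powR; rewrite ?nnegrE ?ler01 ?(ltW t0) ?(ltW t1) ?subr_ge0.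
by rewrite powR1.
Qed.

Lemma eGamma_lty (R : realType) (x : R) (k : nat) : 1 <= x <= 2 -> (eGamma (k%:R + x) < +oo)%E.
Proof.
move=> x12; elim: k => [|k ih]; first by rewrite add0r eGamma_lty_lt2.
rewrite -natr1 addrAC eGamma_recurrence; last first.
  by case/andP: x12 => x1 _; rewrite (le_trans x1)// lerDr.
apply: lte_mul_pinfty => //; rewrite lee_fin addr_ge0//.
by case/andP: x12 => x1 _; rewrite (le_trans ler01).
Qed.

Lemma eGamma_gt0 (R : realType) (x : R) : 1 <= x -> (0 < eGamma x)%E.
Proof.
move=> x1; apply: (@lt_le_trans _ _ (expR (- 1))%:E); first by rewrite lte_fin expR_gt0.
rewrite -integral_expRN.
apply: (@le_trans _ _ (\int[lebesgue_measure]_(t in `[1%R, +oo[)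
    (t `^ (x - 1) * expR (- t))%:E)%E).
  apply: ge0_le_integral => //.
  - by apply/measurable_EFinP; exact: measurable_expRN.
  - by apply/measurable_EFinP; exact: measurable_Gamma_integrand.
  - move=> t /=; rewrite in_itv/= andbT => t1; rewrite lee_fin ler_peMl ?expR_ge0//.
    by have := ler_powR t1 (_ : 0 <= x - 1); rewrite powRr0 subr_ge0; apply.
apply: ge0_subset_integral => //.
- by apply/measurable_EFinP; exact: measurable_Gamma_integrand.
- by move=> t _; rewrite lee_fin mulr_ge0// ?powR_ge0// expR_ge0.
- by move=> t /=; rewrite !in_itv/= !andbT; exact: lt_le_trans.
Qed.

Lemma GammaE (R : realType) (x : R) : Gamma x = fine (eGamma x).
Proof. by []. Qed.

Lemma Gamma_gt0 (R : realType) (x : R) (k : nat) : 1 <= x <= 2 -> 0 < Gamma (k%:R + x).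
Proof.
move=> x12; rewrite GammaE fine_gt0// eGamma_lty// andbT eGamma_gt0//.
by case/andP: x12 => x1 _; rewrite (le_trans x1)// lerDr.
Qed.

Lemma Gamma_recurrence (R : realType) (x : R) (k : nat) : 1 <= x <= 2 ->
  Gamma (k.+1%:R + x) = (k%:R + x) * Gamma (k%:R + x).
Proof.
move=> x12; have x1 : 1 <= k%:R + x.
  by case/andP: x12 => x1 _; rewrite (le_trans x1)// lerDr.
rewrite -natr1 addrAC !GammaE eGamma_recurrence// fineM//.
by rewrite ge0_fin_numE ?eGamma_lty// ltW// eGamma_gt0.
Qed.

(** * Power series of Bessel functions and the bound on the root *)

(** With [x = nu + 1], the entire function [bessel_entire x j] is
    [F (nu + j)], where [J mu t = (t / 2) `^ mu * F mu (t ^+ 2 / 4)].  The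
    integer shift [j] is a separate argument because differentiation raises the
    order by one. *)
Definition bessel_coef (R : realType) (x : R) (j k : nat) : R :=
  (-1) ^+ k / (k`!%:R * Gamma ((k + j)%:R + x)).

Definition bessel_entire (R : realType) (x : R) (j : nat) (s : R) : R :=
  limn (pseries (bessel_coef x j) s).

Lemma pseries_diffs_bessel (R : realType) (x : R) (j : nat) :
  pseries_diffs (bessel_coef x j) = - bessel_coef x j.+1.
Proof.
apply/funext => k; rewrite /pseries_diffs /bessel_coef opprfctE addSnnS.
rewrite factS natrM exprS mulN1r mulNr mulrN; congr (- _).
rewrite mulrCA; congr (_ * _); by rewrite -mulrA [X in _ * X]invfM mulVKf.
Qed.

Lemma Gamma_min (R : realType) (x : R) (k : nat) : 1 <= x <= 2 ->
  Gamma x <= Gamma (k%:R + x).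
Proof.
move=> x12; elim: k => [|k ih]; first by rewrite add0r.
rewrite Gamma_recurrence// (le_trans ih)// ler_peMl//; first exact/ltW/Gamma_gt0.
by case/andP: x12 => x1 _; rewrite (le_trans x1)// lerDr.
Qed.

Lemma is_cvg_bessel (R : realType) (x : R) (j : nat) (s : R) : 1 <= x <= 2 ->
  cvgn (pseries (bessel_coef x j) s).
Proof.
move=> x12; apply: normed_cvg.
have G0 : 0 < Gamma x by have := @Gamma_gt0 _ x 0 x12; rewrite add0r.
apply: (@series_le_cvg _ _ ((Gamma x)^-1 *: exp_coeff `|s|)).
- by move=> n /=.
- move=> n /=; apply: mulr_ge0; first by rewrite invr_ge0 ltW.
  by rewrite exp_coeff_ge0.
- move=> n /=; rewrite /bessel_coef normrM normrM normrX normrN1 expr1n mul1r.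
  rewrite normfV [`|_ * _|]ger0_norm; last by rewrite mulr_ge0// ltW// Gamma_gt0.
  rewrite normrX invfM mulrAC [X in _ <= X]mulrC ler_pM//.
  + by rewrite invr_ge0 ltW// Gamma_gt0.
  + by rewrite mulrC.
  + by rewrite lef_pV2 ?posrE ?Gamma_min// Gamma_gt0.
- by apply: is_cvg_seriesZ; exact: is_cvg_series_exp_coeff.
Qed.

Lemma pseriesN (R : realType) (c : nat -> R) (s : R) :
  pseries (- c) s = - pseries c s.
Proof.
apply/funext => n; transitivity (- \sum_(0 <= i < n) (c i * s ^+ i)); last by [].
rewrite -sumrN /pseries /series/=.
by apply: eq_bigr => k _; rewrite mulNr.
Qed.

Lemma is_derive_bessel_entire (R : realType) (x : R) (j : nat) (s : R) : 1 <= x <= 2 ->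
  is_derive s 1 (bessel_entire x j) (- bessel_entire x j.+1 s).
Proof.
move=> x12.
have E : limn (pseries (pseries_diffs (bessel_coef x j)) s) = - bessel_entire x j.+1 s.
  by rewrite pseries_diffs_bessel pseriesN limN//; exact: is_cvg_bessel.
have cN j' (t : R) : cvgn (pseries (- bessel_coef x j') t).
  by rewrite pseriesN; apply: is_cvgN; exact: is_cvg_bessel.
rewrite -E; apply: (@pseries_snd_diffs _ _ (`|s| + 1)).
- exact: is_cvg_bessel.
- by rewrite pseries_diffs_bessel.
- rewrite pseries_diffs_bessel pseries_diffsN pseries_diffs_bessel opprK; exact: is_cvg_bessel.
- by rewrite [ltRHS]ger0_norm ?ltrDl// addr_ge0.
Qed.

Lemma bessel_entire0 (R : realType) (x : R) (j : nat) : 1 <= x <= 2 ->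
  bessel_entire x j 0 = (Gamma (j%:R + x))^-1.
Proof.
move=> x12; apply: cvg_lim => //; rewrite -cvg_shiftS.
rewrite (_ : (fun n => _) = cst (Gamma (j%:R + x))^-1); first exact: cvg_cst.
apply/funext => n; rewrite /pseries /series/= big_nat_recl//= big1 ?addr0.
  by rewrite /bessel_coef !expr0 fact0 mulr1 !mul1r.
by move=> i _; rewrite exprS mul0r mulr0.
Qed.

(** Coefficient by coefficient this is [1 / Gamma (k + j + x) =
    (k + j + x) / Gamma (k + j + x + 1)]; the factor [k] turns one of the two
    terms into [s] times a derivative. *)
Lemma bessel_contiguous (R : realType) (x : R) (j : nat) (s : R) : 1 <= x <= 2 ->
  bessel_entire x j s =
    (j%:R + x) * bessel_entire x j.+1 s - s * bessel_entire x j.+2 s.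
Proof.
move=> x12.
have dE : limn (pseries (pseries_diffs (bessel_coef x j.+1)) s) = - bessel_entire x j.+2 s.
  by rewrite pseries_diffs_bessel pseriesN limN//; exact: is_cvg_bessel.
have cd : cvgn (pseries (pseries_diffs (bessel_coef x j.+1)) s).
  by rewrite pseries_diffs_bessel pseriesN; apply: is_cvgN; exact: is_cvg_bessel.
have H := pseries_diffs_equiv cd; rewrite dE in H.
have coefE k : bessel_coef x j k =
    (j%:R + x) * bessel_coef x j.+1 k + k%:R * bessel_coef x j.+1 k.
  have kx : (k + j)%:R + x != 0.
    by case/andP: x12 => x1 _; rewrite gt_eqF// (lt_le_trans ltr01)// (le_trans x1)// lerDr.
  rewrite -mulrDl /bessel_coef addnS Gamma_recurrence//.
  rewrite (_ : j%:R + x + k%:R = (k + j)%:R + x); last by rewrite natrD; ring.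
  have := Gamma_gt0 (k + j) x12.
  have : (0 : R) < k`!%:R by rewrite ltr0n fact_gt0.
  by move=> f0 g0; field; rewrite -natrD kx !gt_eqF.
apply: cvg_lim => //.
have -> : pseries (bessel_coef x j) s =
   (fun n => (j%:R + x) * pseries (bessel_coef x j.+1) s n +
     s * series (fun i => i%:R * bessel_coef x j.+1 i * s ^+ i.-1) n).
  apply/funext => n; rewrite /pseries /series/= !mulr_sumr -big_split/=.
  apply: eq_bigr => -[|k] _; rewrite coefE; first by rewrite !expr0; ring.
  by rewrite exprS; ring.
rewrite -mulrN; apply: cvgD; apply: cvgMr => //; exact: is_cvg_bessel.
Qed.

Lemma continuous_bessel_entire (R : realType) (x : R) (j : nat) : 1 <= x <= 2 ->
  continuous (bessel_entire x j).
Proof.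
move=> x12 s; apply/differentiable_continuous/derivable1_diffP.
by have [] := is_derive_bessel_entire j s x12.
Qed.

(** The contiguous relation says that [t `^ (j + x) * bessel_entire x j.+1 t]
    has derivative [t `^ (j + x - 1) * bessel_entire x j t], so nonnegativity
    passes from the order [j] to the order [j.+1]. *)
Lemma bessel_entire_ge0_succ (R : realType) (x : R) (j : nat) (s : R) :
  1 <= x <= 2 -> (forall t, 0 < t <= s -> 0 <= bessel_entire x j t) ->
  forall t, 0 < t <= s -> 0 <= bessel_entire x j.+1 t.
Proof.
move=> x12 F0 t /andP[t0 ts].
have jx1 : 1 <= j%:R + x.
  by case/andP: x12 => x1 _; rewrite (le_trans x1)// lerDr.
have jx0 : 0 < j%:R + x by rewrite (lt_le_trans ltr01).
pose P u := u `^ (j%:R + x) * bessel_entire x j.+1 u.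
have dP (u : R) : 0 < u -> is_derive u 1 P (u `^ (j%:R + x - 1) * bessel_entire x j u).
  move=> u0.
  have h1 := is_derive1_powR (j%:R + x) u0.
  have h2 := is_derive_bessel_entire j.+1 u x12.
  have h3 := is_deriveM h1 h2; apply: is_derive_eq.
  rewrite (bessel_contiguous j u x12) -[u `^ (j%:R + x)]mulr_powRB1 ?(ltW u0)//.
  rewrite /GRing.scale/=.
  move: (u `^ (j%:R + x - 1)) (bessel_entire x j.+1 u) (bessel_entire x j.+2 u)
    (j%:R + x) => p q r k.
  by ring.
have cF : {within `[0, t], continuous (bessel_entire x j.+1)}.
  by apply: continuous_subspaceT; exact: continuous_bessel_entire.
have cP : {within `[0, t], continuous P}.
  move=> u; apply: cvgM; first exact: (powR_within_continuous (ltW jx0) t0).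
  exact: cF.
have := @ger0_derive1_le_cc R P 0 t _ _ cP 0 t.
rewrite /P powR0 ?gt_eqF// mul0r pmulr_rge0 ?powR_gt0//; apply.
- by move=> u; rewrite in_itv/= => /andP[u0 _]; have [] := dP u u0.
- move=> u; rewrite in_itv/= => /andP[u0 ut]; rewrite derive1E.
  have [_ ->] := dP u u0; rewrite mulr_ge0 ?powR_ge0// F0// u0/=.
  exact/ltW/(lt_le_trans ut).
- by rewrite in_itv/= lexx ltW.
- by rewrite in_itv/= lexx ltW.
- exact: ltW.
Qed.

Lemma besselJE (R : realType) (nu y : R) : 0 <= nu <= 1 -> 0 < y ->
  besselJ nu y = (y / 2) `^ nu * bessel_entire (nu + 1) 0 (y ^+ 2 / 4).
Proof.
move=> nu01 y0.
have x12 : 1 <= nu + 1 <= 2 by lra.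
rewrite /besselJ /bessel_entire; apply: cvg_lim => //.
rewrite (_ : series _ = (fun n => (y / 2) `^ nu *
    pseries (bessel_coef (nu + 1) 0) (y ^+ 2 / 4) n)).
  by apply: cvgMr; exact: is_cvg_bessel.
apply/funext => n; rewrite /pseries /series/= mulr_sumr; apply: eq_bigr => k _.
have y20 : 0 < y / 2 by rewrite divr_gt0.
rewrite /bessel_coef addn0 addrA [RHS]mulrCA; congr (_ * _).
rewrite powRD ?(gt_eqF y20) ?implybT// mulrC; congr (_ * _).
rewrite -natrM powR_mulrn ?(ltW y20)// exprM; congr (_ ^+ _).
by rewrite expr_div_n; congr (_ / _); ring.
Qed.

Lemma is_derive_besselJ (R : realType) (nu y : R) : 0 <= nu <= 1 -> 0 < y ->
  is_derive y 1 (besselJ nu)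
    ((y / 2) `^ nu / y * (nu * bessel_entire (nu + 1) 0 (y ^+ 2 / 4)
       - 2 * (y ^+ 2 / 4) * bessel_entire (nu + 1) 1 (y ^+ 2 / 4))).
Proof.
move=> nu01 y0.
have x12 : 1 <= nu + 1 <= 2 by lra.
have y20 : 0 < y / 2 by rewrite divr_gt0.
pose B z := (z / 2) `^ nu * bessel_entire (nu + 1) 0 (z ^+ 2 / 4).
suff dB : is_derive y 1 B ((y / 2) `^ nu / y * (nu * bessel_entire (nu + 1) 0 (y ^+ 2 / 4)
       - 2 * (y ^+ 2 / 4) * bessel_entire (nu + 1) 1 (y ^+ 2 / 4))).
  apply: near_eq_is_derive dB; near=> z.
  have z0 : 0 < z by near: z; exact: lt_nbhsr.
  by rewrite besselJE.
have h1 : is_derive (y / 2) 1 (fun u : R => u `^ nu) (nu * (y / 2) `^ (nu - 1)).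
  exact: is_derive1_powR.
have h1' : is_derive y 1 (fun z : R => z / 2) (2^-1).
  by apply: is_derive_eq; rewrite /GRing.scale/=; ring.
have h2 := is_derive_bessel_entire 0 (y ^+ 2 / 4) x12.
have h2' : is_derive y 1 (fun z : R => z ^+ 2 / 4) (y / 2).
  by apply: is_derive_eq; rewrite /GRing.scale/=; field.
have h3 := @is_derive1_comp R (fun u : R => u `^ nu) (fun z => z / 2) y _ _ h1 h1'.
have h4 := @is_derive1_comp R (bessel_entire (nu + 1) 0) (fun z => z ^+ 2 / 4) y _ _ h2 h2'.
have h5 := is_deriveM h3 h4.
apply: is_derive_eq; rewrite /GRing.scale/=.
have -> : (y / 2) `^ (nu - 1) = (y / 2) `^ nu / (y / 2).
  by rewrite powRB ?(gt_eqF y20) ?implybT// powRr1// ltW.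
move: ((y / 2) `^ nu) (bessel_entire (nu + 1) 0 (y ^+ 2 / 4))
  (bessel_entire (nu + 1) 1 (y ^+ 2 / 4)) => p q r.
by field; rewrite gt_eqF.
Unshelve. all: by end_near. Qed.

Lemma bessel_entire_gt0 (R : realType) (nu j : R) : 0 <= nu <= 1 ->
  is_first_bessel_zero nu j ->
  forall s, 0 <= s < j ^+ 2 / 4 -> 0 < bessel_entire (nu + 1) 0 s.
Proof.
move=> nu01 [j0 _ Jn0] s /andP[s0 sj].
have x12 : 1 <= nu + 1 <= 2 by lra.
have F0 : 0 < bessel_entire (nu + 1) 0 0.
  by rewrite bessel_entire0// invr_gt0 Gamma_gt0.
rewrite ltNge; apply/negP => Fs.
have cF : {within `[0, s], continuous (bessel_entire (nu + 1) 0)}.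
  by apply: continuous_subspaceT; exact: continuous_bessel_entire.
have [|t] := IVT s0 cF (_ : Num.min _ _ <= 0 <= Num.max _ _).
  by rewrite ge_min le_max Fs (ltW F0) orbT.
rewrite in_itv/= => /andP[t0 ts] Ft.
have {}t0 : 0 < t.
  rewrite lt_neqAle t0 andbT; apply/eqP => t00.
  by move: Ft; rewrite -t00 => Ft; move: F0; rewrite Ft ltxx.
have st0 : 0 < Num.sqrt t by rewrite sqrtr_gt0.
apply: (Jn0 (2 * Num.sqrt t)).
  rewrite mulr_gt0//= -(@ltr_pXn2r _ 2) ?nnegrE ?mulr_ge0 ?(ltW st0) ?(ltW j0)//.
  rewrite exprMn sqr_sqrtr ?(ltW t0)//; move: (le_lt_trans ts sj); lra.
rewrite besselJE ?mulr_gt0//.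
have -> : (2 * Num.sqrt t) ^+ 2 / 4 = t.
  by rewrite exprMn sqr_sqrtr ?(ltW t0)//; field.
by rewrite Ft mulr0.
Qed.

(** At a root, [(alpha - lambda) F nu = m s F (nu + 1)] with [s = (c / m) ^+ 2]
    and [alpha = (1 + nu m) / 2].  Before the first zero [F (nu + 2) >= 0], so the
    contiguous relation gives [F nu <= (nu + 1) F (nu + 1)], whence a bound on
    [c ^+ 2 = m ^+ 2 * s]. *)
Lemma bessel_c_root_bound (R : realType) (nu m lambda c : R) :
  1 < m -> 0 <= nu <= 1 -> 0 <= lambda < (1 + nu * m) / 2 ->
  is_bessel_c_root nu m lambda c ->
  c ^+ 2 <= m * (1 + nu) * ((1 + nu * m) / 2 - lambda).
Proof.
move=> m1 nu01 /andP[l0 lal] [/andP[y0 yj] eqc].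
have x12 : 1 <= nu + 1 <= 2 by lra.
have m0 : 0 < m by lra.
have first : is_first_bessel_zero nu (bessel_zero nu).
  move: (lt_trans y0 yj); rewrite /bessel_zero; case: xgetP => //.
  by move=> _; rewrite ltxx.
set y := 2 / m * c in y0 yj eqc.
have cE : c = m * y / 2 by rewrite /y; field; rewrite gt_eqF.
set s := y ^+ 2 / 4.
have s0 : 0 < s by rewrite divr_gt0// exprn_gt0.
have sj : s < bessel_zero nu ^+ 2 / 4.
  rewrite ltr_pM2r// ltr_pXn2r// nnegrE ltW//; exact: lt_trans yj.
have F0 t : 0 < t <= s -> 0 <= bessel_entire (nu + 1) 0 t.
  move=> /andP[t0 ts]; apply/ltW/(bessel_entire_gt0 nu01 first).
  by rewrite (ltW t0) (le_lt_trans ts).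
have F1 := bessel_entire_ge0_succ x12 F0.
have F2 := bessel_entire_ge0_succ x12 F1.
have ss : 0 < s <= s by rewrite s0 lexx.
have {F1}F1s := F1 s ss; have {F2}F2s := F2 s ss.
have {F0}F0s : 0 < bessel_entire (nu + 1) 0 s.
  by apply: (bessel_entire_gt0 nu01 first); rewrite ltW.
have cont := bessel_contiguous 0 s x12.
move: eqc; rewrite derive1E; have [_ ->] := is_derive_besselJ nu01 y0.
rewrite besselJE// -/s.
have py : 0 < (y / 2) `^ nu by rewrite powR_gt0// divr_gt0.
move: py F0s F1s F2s cont; rewrite add0r.
move: ((y / 2) `^ nu) (bessel_entire (nu + 1) 0 s) (bessel_entire (nu + 1) 1 s)
  (bessel_entire (nu + 1) 2 s) => p f0 f1 f2 p0 f00 f10 f20 cont.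
rewrite cE => eqc.
have {}eqc : ((1 + nu * m) / 2 - lambda) * f0 = m * s * f1.
  have : p * (2 * (((1 + nu * m) / 2 - lambda) * f0 - m * s * f1)) = 0.
    rewrite -eqc; field; exact: lt0r_neq0.
  by move/eqP; rewrite mulf_eq0 gt_eqF//= mulf_eq0 pnatr_eq0/= subr_eq0 => /eqP.
have cs : c ^+ 2 = m ^+ 2 * s by rewrite cE /s; field.
rewrite -cE cs.
have f1p : 0 < f1.
  rewrite lt_neqAle f10 andbT; apply/eqP => f1E; move: eqc; rewrite -f1E mulr0 => /eqP.
  by rewrite mulf_eq0 (gt_eqF f00) orbF subr_eq0 gt_eqF.
have ms : m * s <= (nu + 1) * ((1 + nu * m) / 2 - lambda).
  rewrite -(ler_pM2r f1p) -eqc [leRHS]mulrAC [leRHS]mulrC ler_pM2l ?subr_gt0//.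
  by rewrite cont lerBlDr lerDl mulr_ge0// ltW.
rewrite expr2 -!mulrA ler_pM2l// (le_trans ms)// [1 + nu]addrC lexx//.
Qed.

(** Where there is no root, [bessel_c] is 0 and the bound is trivial. *)
Lemma bessel_c_bound (R : realType) (nu m lambda : R) :
  1 < m -> 0 <= nu <= 1 / m -> 0 <= lambda < (1 + nu * m) / 2 ->
  bessel_c nu m lambda ^+ 2 <= m * (1 + nu) * ((1 + nu * m) / 2 - lambda).
Proof.
move=> m1 /andP[nu0 num] lam.
have nu01 : 0 <= nu <= 1.
  by rewrite nu0 (le_trans num)// ler_pdivrMr ?mul1r ?ltW// (lt_trans ltr01).
rewrite /bessel_c; case: xgetP => [c _ [croot _]|_].
  exact: bessel_c_root_bound.
case/andP: lam => l0 lam; rewrite expr0n/= !mulr_ge0 ?subr_ge0 ?(ltW lam)//; lra.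
Qed.

(** * The scalar inequality between the constants *)

(** Bernoulli's inequality, as Young's inequality with second factor 1. *)
Lemma powR_ge_tangent (R : realType) (y r : R) : 0 <= y -> 1 <= r ->
  1 + r * (y - 1) <= y `^ r.
Proof.
move=> y0; rewrite le_eqVlt => /predU1P[<-|r1]; first by rewrite powRr1//; lra.
have r0 : 0 < r by rewrite (lt_trans ltr01).
have r10 : 0 < r - 1 by rewrite subr_gt0.
have q0 : 0 < r / (r - 1) by rewrite divr_gt0.
have := @conjugate_powR R y 1 r (r / (r - 1)) y0 ler01 r0 q0.
rewrite powR1 mulr1 mul1r invf_div => /(_ _)H.
have {H} : y <= y `^ r / r + (r - 1) / r.
  by apply: H; field; rewrite gt_eqF.
rewrite -mulrDl ler_pdivlMr//; lra.
Qed.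

(** The difference [t - t `^ m] is largest where [t `^ m] has slope 1, so the
    tangent there bounds it. *)
Lemma sub_powR_le (R : realType) (m t : R) : 1 < m -> 0 <= t ->
  (m + 1) * (t - t `^ m) <= m - 1.
Proof.
move=> m1 t0; have m0 : 0 < m by rewrite (lt_trans ltr01).
have m10 : 0 < m - 1 by rewrite subr_gt0.
(* since [sigma `^ m = m * sigma], the tangent inequality at [sigma * t] divided
   by [sigma `^ m] has slope 1 in [t] *)
pose sigma := expR (ln m / (m - 1)).
have sigma_gt0 : 0 < sigma by exact: expR_gt0.
have sigmaM : sigma `^ m = m * sigma.
  rewrite -[X in X * sigma](lnK (m0 : m \in Num.pos)) /sigma -expRD.
  rewrite /powR gt_eqF ?expR_gt0// expRK.
  by congr expR; field; rewrite gt_eqF.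
have sigma_ge : m + 1 <= m * sigma.
  have lnm : 1 - m^-1 <= ln m.
    have := @le_ln1Dx R (m^-1 - 1).
    rewrite [1 + (m^-1 - 1)]addrC subrK lnV ?posrE// => /(_ _) H.
    have : - ln m <= m^-1 - 1.
      by apply: H; rewrite ltrBrDl subrr invr_gt0.
    lra.
  have : m^-1 <= ln m / (m - 1).
    rewrite ler_pdivlMr// (le_trans _ lnm)// mulrBr mulVf ?gt_eqF// mulr1//.
  rewrite -ler_expR -/sigma => h; have := le_trans (expR_ge1Dx _) h.
  rewrite -(ler_pM2l m0) mulrDr mulr1 divff ?gt_eqF//.
have := @powR_ge_tangent R (sigma * t) m _ (ltW m1).
rewrite mulr_ge0 ?(ltW sigma_gt0)// => /(_ isT).
rewrite powRM ?(ltW sigma_gt0)// sigmaM => tangent.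
have [tm|tm] := leP (t - t `^ m) 0.
  by rewrite (@le_trans _ _ 0) ?(ltW m10)// mulr_ge0_le0// addr_ge0 ?(ltW m0).
rewrite (@le_trans _ _ (m * sigma * (t - t `^ m)))//; first by rewrite ler_pM2r.
lra.
Qed.

(** The algebra behind the constants, with [alpha = (1 + nu m) / 2] and [T = t `^ m]: when
    the bound on [c2] is an equality, the right side minus the left side is
    [4 (lambda - lambda ^+ 2) T + 4 (alpha - lambda) (T + (alpha + lambda) (1 - t)
    - 2 alpha (t - T) / (m - 1))], and [sub_powR_le] makes the second summand
    nonnegative because [alpha <= 1]. *)
Lemma weight_bound (R : realType) (m nu lambda c2 t : R) :
  1 < m -> 0 <= nu <= 1 / m -> 0 <= lambda < (1 + nu * m) / 2 ->
  c2 <= m * (1 + nu) * ((1 + nu * m) / 2 - lambda) -> 0 <= t <= 1 ->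
  (1 - nu ^+ 2 * m ^+ 2) * (1 - t) +
    4 * (c2 + (m - 1) * (lambda - lambda ^+ 2)) * ((t - t `^ m) / (m - 1))
  <= 2 * (1 + nu * m) - 4 * lambda ^+ 2.
Proof.
move=> m1 /andP[nu0 num] /andP[l0 lal] c2le /andP[t0 t1].
have m0 : 0 < m by rewrite (lt_trans ltr01).
have m10 : 0 < m - 1 by rewrite subr_gt0.
have := sub_powR_le m1 t0.
have Tt : t `^ m <= t.
  have [->|tn0] := eqVneq t 0; first by rewrite powR0 ?gt_eqF.
  by rewrite ge1r_powR ?(ltW m1)// lt_neqAle eq_sym tn0 t0.
have := powR_ge0 t m; move: Tt; set T := t `^ m => Tt T0.
pose y := (t - T) / (m - 1).
have y0 : 0 <= y by rewrite divr_ge0 ?subr_ge0 ?(ltW m1).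
have TE : T = t - (m - 1) * y by rewrite /y; field; rewrite gt_eqF.
rewrite -/y => ym; have {}ym : (m + 1) * y <= 1.
  by rewrite /y mulrA ler_pdivrMr// mul1r.
pose al := (1 + nu * m) / 2.
have nuE : nu * m = 2 * al - 1 by rewrite /al; field.
have al1 : al <= 1.
  by rewrite /al; move: num; rewrite ler_pdivlMr//; lra.
rewrite -exprMn nuE; rewrite -/al in c2le lal.
have {}c2le : c2 <= (m + 2 * al - 1) * (al - lambda).
  by rewrite (_ : m + 2 * al - 1 = m * (1 + nu))// mulrDr mulr1 [m * nu]mulrC nuE addrA.
have h1 : 0 <= (lambda - lambda ^+ 2) * T.
  rewrite mulr_ge0// subr_ge0 expr2 ler_piMl//; lra.
have h2 : 0 <= (al - lambda) * (T + (al + lambda) * (1 - t) - 2 * al * y).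
  rewrite mulr_ge0 ?subr_ge0 ?(ltW lal)//.
  have a0 : 0 <= al * (1 - (m + 1) * y) by rewrite mulr_ge0 ?subr_ge0//; lra.
  have a1 : 0 <= (1 - al) * T by rewrite mulr_ge0 ?subr_ge0.
  have a2 : 0 <= lambda * (1 - t) by rewrite mulr_ge0 ?subr_ge0.
  move: a0 a1 a2; rewrite TE; lra.
have h3 : 0 <= ((m + 2 * al - 1) * (al - lambda) - c2) * y.
  by rewrite mulr_ge0 ?subr_ge0.
move: h1 h2 h3; rewrite TE; lra.
Qed.

(** * The multiplier *)

(** The antiderivative, vanishing at [d0], of minus the weight
    [kappa / t ^+ 2 + gam / d0 `^ m * t `^ (m - 2)]. *)
Definition primitive_weight (R : realType) (kappa gam m d0 t : R) : R :=
  kappa * (t^-1 - d0^-1) + gam / d0 `^ m * ((d0 `^ (m - 1) - t `^ (m - 1)) / (m - 1)).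

Lemma primitive_weight_end (R : realType) (kappa gam m d0 : R) :
  primitive_weight kappa gam m d0 d0 = 0.
Proof. by rewrite /primitive_weight !subrr mul0r !mulr0 addr0. Qed.

Lemma is_derive_primitive_weight (R : realType) (kappa gam m d0 t : R) :
  1 < m -> 0 < t ->
  is_derive t 1 (primitive_weight kappa gam m d0)
    (- (kappa / t ^+ 2 + gam / d0 `^ m / t `^ (2 - m))).
Proof.
move=> m1 t0; have tn0 : t != 0 by rewrite gt_eqF.
have h1 : is_derive t 1 (fun u : R => u^-1) (- t ^- 2).
  by apply: is_derive_eq (is_deriveV tn0 (is_derive_id t 1)) _; rewrite /GRing.scale/= mulr1.
have h2 := is_derive1_powR (m - 1) t0.
rewrite /primitive_weight; apply: is_derive_eq.
have -> : t `^ (m - 1 - 1) = (t `^ (2 - m))^-1.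
  by rewrite -powRN; congr powR; ring.
rewrite /GRing.scale/=; move: (gam / d0 `^ m) ((t `^ (2 - m))^-1) => u v.
by field; rewrite subr_eq0 (gt_eqF m1) tn0.
Qed.

(** Up to the scaling [s = t / d0], the upper bound is the hypothesis. *)
Lemma primitive_weight_bounds (R : realType) (kappa gam m d0 A t : R) :
  0 <= kappa -> 0 <= gam -> 1 < m -> 0 < d0 ->
  (forall s, 0 <= s <= 1 -> kappa * (1 - s) + gam * ((s - s `^ m) / (m - 1)) <= A) ->
  0 < t <= d0 -> 0 <= primitive_weight kappa gam m d0 t <= A / t.
Proof.
move=> k0 g0 m1 d00 H /andP[t0 td].
have m10 : 0 < m - 1 by rewrite subr_gt0.
apply/andP; split.
  rewrite addr_ge0//.
    by rewrite mulr_ge0// subr_ge0 lef_pV2.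
  rewrite mulr_ge0 ?divr_ge0 ?powR_ge0 ?(ltW m10)// subr_ge0.
  by apply: ge0_ler_powR; rewrite ?nnegrE ?(ltW m10) ?(ltW t0) ?(ltW d00).
have s01 : 0 <= t / d0 <= 1 by rewrite divr_ge0 ?(ltW t0) ?(ltW d00)//= ler_pdivrMr ?mul1r.
rewrite ler_pdivlMr//; apply: le_trans (H _ s01); rewrite le_eqVlt; apply/orP; left; apply/eqP.
have -> : (t / d0) `^ m = t `^ m / d0 `^ m.
  have dm0 : d0 `^ m != 0 by rewrite gt_eqF// powR_gt0.
  apply: (mulIf dm0); rewrite -powRM ?divr_ge0 ?(ltW t0) ?(ltW d00)//.
  by rewrite !divfK// gt_eqF.
rewrite -[t `^ m]mulr_powRB1 ?(ltW t0)//; last by lra.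
rewrite -[d0 `^ m]mulr_powRB1 ?(ltW d00)//; last by lra.
rewrite /primitive_weight -[d0 `^ m]mulr_powRB1 ?(ltW d00)//; last by lra.
have : 0 < d0 `^ (m - 1) by exact: powR_gt0.
move: (t `^ (m - 1)) (d0 `^ (m - 1)) => u v v0.
by field; rewrite !gt_eqF.
Qed.

Lemma primitive_weight_lipschitz (R : realType) (kappa gam m d0 e : R) :
  0 <= kappa -> 0 <= gam -> 1 < m -> 0 < e -> e <= d0 ->
  exists2 K : R, 0 <= K & forall x y, e <= x -> x <= y -> y <= d0 ->
    `|primitive_weight kappa gam m d0 y - primitive_weight kappa gam m d0 x| <= K * (y - x).
Proof.
move=> k0 g0 m1 e0 ed.
have d00 := lt_le_trans e0 ed.
have c0 : 0 <= gam / d0 `^ m by rewrite divr_ge0 ?powR_ge0.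
exists (kappa / e ^+ 2 + gam / d0 `^ m * (d0 `^ m / e ^+ 2)).
  have e20 : 0 <= e ^+ 2 by rewrite exprn_ge0// ltW.
  by rewrite addr_ge0 ?mulr_ge0 ?invr_ge0 ?powR_ge0.
move=> x y ex xy yd.
have x0 := lt_le_trans e0 ex.
have dW u : u \in `]x, y[ -> is_derive u 1 (primitive_weight kappa gam m d0)
    (- (kappa / u ^+ 2 + gam / d0 `^ m / u `^ (2 - m))).
  rewrite in_itv/= => /andP[xu _]; apply: is_derive_primitive_weight => //.
  exact: lt_trans xu.
have cW : {within `[x, y], continuous (primitive_weight kappa gam m d0)}.
  apply: derivable_within_continuous => u; rewrite in_itv/= => /andP[xu _].
  by have [] := is_derive_primitive_weight kappa gam d0 m1 (lt_le_trans x0 xu).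
have [u] := MVT_segment xy dW cW; rewrite in_itv/= => /andP[xu uy] ->.
have u0 := lt_le_trans x0 xu.
rewrite normrM normrN [`|y - x|]ger0_norm ?subr_ge0// ler_wpM2r ?subr_ge0//.
have eu2 : e ^+ 2 <= u ^+ 2.
  by rewrite ler_pXn2r// ?nnegrE ?(ltW e0) ?(ltW u0)// (le_trans ex).
rewrite ger0_norm; last first.
  have u20 : 0 <= u ^+ 2 by rewrite exprn_ge0// ltW.
  by rewrite addr_ge0 ?mulr_ge0 ?invr_ge0 ?powR_ge0.
apply: lerD; first by rewrite ler_wpM2l// lef_pV2 ?posrE ?exprn_gt0.
rewrite ler_wpM2l// -powRN.
have -> : - (2 - m) = m - 2%:R by ring.
have -> : u `^ (m - 2) = u `^ m / u ^+ 2.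
  rewrite powRB; last by rewrite (gt_eqF u0) ?implybT.
  by rewrite (powR_mulrn 2 (ltW u0)).
apply: ler_pM; rewrite ?powR_ge0 ?invr_ge0 ?exprn_ge0 ?(ltW u0)//.
  apply: ge0_ler_powR; rewrite ?nnegrE ?(ltW d00) ?(ltW u0) ?(le_trans uy)//; lra.
by rewrite lef_pV2 ?posrE ?exprn_gt0.
Qed.

(** The function [W] whose derivative is minus the weight at the distance to the
    nearer endpoint.  The truncation at [d0] makes each of the two terms vanish on
    the half of the interval that belongs to the other, and the truncation at [e]
    keeps the sum Lipschitz near the endpoints. *)
Definition hardy_multiplier (R : realType) (kappa gam m a b e x : R) : R :=
  let d0 := (b - a) / 2 in
  primitive_weight kappa gam m d0 (clip e d0 (x - a))
  - primitive_weight kappa gam m d0 (clip e d0 (b - x)).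

Lemma clip_top (R : realType) (a b x : R) : b <= x -> clip a b x = b.
Proof. by move=> bx; rewrite /clip (min_idPl _)// le_max bx orbT. Qed.

Lemma hardy_multiplier_left (R : realType) (kappa gam m a b e x : R) :
  x <= (a + b) / 2 ->
  hardy_multiplier kappa gam m a b e x =
    primitive_weight kappa gam m ((b - a) / 2) (clip e ((b - a) / 2) (x - a)).
Proof.
move=> xc; rewrite /hardy_multiplier (@clip_top _ _ _ (b - x)); last by lra.
by rewrite primitive_weight_end subr0.
Qed.

Lemma hardy_multiplier_right (R : realType) (kappa gam m a b e x : R) :
  (a + b) / 2 <= x ->
  hardy_multiplier kappa gam m a b e x =
    - primitive_weight kappa gam m ((b - a) / 2) (clip e ((b - a) / 2) (b - x)).
Proof.
move=> xc; rewrite /hardy_multiplier (@clip_top _ _ _ (x - a)); last by lra.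
by rewrite primitive_weight_end sub0r.
Qed.

Lemma hardy_multiplier_bound (R : realType) (kappa gam m a b e A x : R) :
  0 <= kappa -> 0 <= gam -> 1 < m -> a < b -> 0 < e -> e <= (b - a) / 2 ->
  (forall s, 0 <= s <= 1 -> kappa * (1 - s) + gam * ((s - s `^ m) / (m - 1)) <= A) ->
  a < x < b ->
  `|hardy_multiplier kappa gam m a b e x| <= A / bdist a b x.
Proof.
move=> k0 g0 m1 ab e0 ed H /andP[ax xb].
have d00 : 0 < (b - a) / 2 by rewrite divr_gt0// subr_gt0.
have half (t : R) : 0 < t -> t <= (b - a) / 2 ->
    `|primitive_weight kappa gam m ((b - a) / 2) (clip e ((b - a) / 2) t)| <= A / t.
  move=> t0 td; set c := clip _ _ _.
  have ce : e <= c by exact: clip_ge.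
  have tc : t <= c by rewrite /c /clip le_min td le_max lexx orbT.
  have cd : 0 < c <= (b - a) / 2 by rewrite (lt_le_trans e0 ce) clip_le.
  have /andP[w0 wA] := primitive_weight_bounds k0 g0 m1 d00 H cd.
  rewrite ger0_norm// (le_trans wA)// ler_wpM2l//; last first.
    by rewrite lef_pV2 ?posrE// (lt_le_trans e0 ce).
  have := H 1; rewrite powR1 !subrr mul0r !mulr0 addr0; apply.
  by rewrite ler01 lexx.
have [xc|/ltW xc] := leP x ((a + b) / 2).
  rewrite hardy_multiplier_left// /bdist (min_idPr _); last by lra.
  by apply: half; [rewrite subr_gt0|lra].
rewrite hardy_multiplier_right// normrN /bdist (min_idPl _); last by lra.
by apply: half; [rewrite subr_gt0|lra].
Qed.

Lemma is_derive_hardy_multiplier (R : realType) (kappa gam m a b e x : R) :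
  1 < m -> 0 < e -> e < bdist a b x -> x != (a + b) / 2 ->
  is_derive x 1 (hardy_multiplier kappa gam m a b e)
    (- (kappa / bdist a b x ^+ 2 + gam / ((b - a) / 2) `^ m / bdist a b x `^ (2 - m))).
Proof.
move=> m1 e0; rewrite {1}/bdist lt_min => /andP[exb exa] xc.
have xa0 := lt_trans e0 exa; have xb0 := lt_trans e0 exb.
have [{}xc|{}xc|xcE] := ltgtP x ((a + b) / 2); last by rewrite xcE eqxx in xc.
  rewrite /bdist (min_idPr _); last by lra.
  have dw := @is_derive_primitive_weight R kappa gam m ((b - a) / 2) _ m1 xa0.
  have dt : is_derive x 1 (fun y : R => y - a) 1 by apply: is_derive_eq; rewrite subr0.
  have := @is_derive1_comp R _ (fun y : R => y - a) x _ _ dw dt; rewrite mulr1.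
  apply: near_eq_is_derive; near=> y; rewrite hardy_multiplier_left; last first.
    by apply: ltW; near: y; exact: lt_nbhsl.
  rewrite /= clip_id//; apply/andP; split.
    rewrite lerBrDl; apply: ltW; near: y; apply: lt_nbhsr; lra.
  suff : y < (a + b) / 2 by lra.
  by near: y; exact: lt_nbhsl.
rewrite /bdist (min_idPl _); last by lra.
have dw := @is_derive_primitive_weight R kappa gam m ((b - a) / 2) _ m1 xb0.
have dt : is_derive x 1 (fun y : R => b - y) (-1).
  by apply: is_derive_eq; rewrite add0r mul1r.
have := @is_derive1_comp R _ (fun y : R => b - y) x _ _ dw dt.
rewrite mulrN1 opprK => dn; have {dn} := is_deriveN dn.
apply: near_eq_is_derive; near=> y; rewrite hardy_multiplier_right; last first.
  by apply: ltW; near: y; exact: lt_nbhsr.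
rewrite /= clip_id//; apply/andP; split.
  suff : y < b - e by lra.
  near: y; apply: lt_nbhsl; lra.
suff : (a + b) / 2 < y by lra.
by near: y; exact: lt_nbhsr.
Unshelve. all: by end_near. Qed.

Lemma hardy_multiplier_lipschitz (R : realType) (kappa gam m a b e : R) :
  0 <= kappa -> 0 <= gam -> 1 < m -> 0 < e -> e <= (b - a) / 2 ->
  exists2 K : R, 0 <= K & forall x y, x <= y ->
    `|hardy_multiplier kappa gam m a b e y - hardy_multiplier kappa gam m a b e x|
      <= K * (y - x).
Proof.
move=> k0 g0 m1 e0 ed.
have [K K0 HK] := primitive_weight_lipschitz k0 g0 m1 e0 ed.
exists (2 * K); first by rewrite mulr_ge0.
have lip (s t : R) : s <= t ->
    `|primitive_weight kappa gam m ((b - a) / 2) (clip e ((b - a) / 2) t)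
      - primitive_weight kappa gam m ((b - a) / 2) (clip e ((b - a) / 2) s)| <= K * (t - s).
  move=> st; apply: (le_trans (HK _ _ _ _ _)); rewrite ?clip_ge ?clip_le ?clip_homo//.
  by rewrite ler_wpM2l// clip_lipschitz.
move=> x y xy; have h1 := lip (x - a) (y - a); have h2 := lip (b - y) (b - x).
rewrite /hardy_multiplier; move: h1 h2.
move: (primitive_weight _ _ _ _ _) (primitive_weight _ _ _ _ _) => p1 p2.
move: (primitive_weight _ _ _ _ _) (primitive_weight _ _ _ _ _) => p3 p4 h1 h2.
have -> : p2 - p3 - (p1 - p4) = (p2 - p1) + (p4 - p3) by ring.
apply: (le_trans (ler_normD _ _)); apply: (le_trans (lerD (h1 _) (h2 _))); lra.
Qed.

(** * Difference quotients and truncations *)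

Lemma powR_increment_le (R : realType) (p u v : R) : 1 <= p -> 0 <= u <= v ->
  v `^ p - u `^ p <= p * v `^ (p - 1) * (v - u).
Proof.
move=> p1 /andP[u0 uv]; have p0 : 0 < p by rewrite (lt_le_trans ltr01).
have [v0|v0] := leP v 0.
  have -> : u = v by apply/eqP; rewrite eq_le uv (le_trans v0).
  by rewrite !subrr mulr0.
have t0 : 0 <= u / v by rewrite divr_ge0// ltW.
have := powR_ge_tangent t0 p1.
have upE : u `^ p = v `^ p * (u / v) `^ p.
  by rewrite -powRM ?(ltW v0)//; congr powR; field; rewrite gt_eqF.
rewrite -(ler_pM2l (powR_gt0 p v0)) -upE.
have vpE : v `^ p = v * v `^ (p - 1) by rewrite mulr_powRB1// ltW.
rewrite vpE; have : 0 < v `^ (p - 1) by exact: powR_gt0.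
move: (v `^ (p - 1)) (u `^ p) => V U V0.
have -> : v * V * (1 + p * (u / v - 1)) = v * V - p * V * (v - u).
  by field; rewrite gt_eqF.
lra.
Qed.

Lemma powRB_le (R : realType) (p s t : R) : 1 <= p -> 0 <= s -> 0 <= t ->
  `|t `^ p - s `^ p| <= p * (s + `|t - s|) `^ (p - 1) * `|t - s|.
Proof.
move=> p1 s0 t0; have p0 : 0 <= p by rewrite (le_trans ler01).
have mono u v : 0 <= u -> u <= v -> u `^ p <= v `^ p.
  by move=> u0 uv; apply: ge0_ler_powR; rewrite ?nnegrE// (le_trans u0).
have [st|ts] := leP s t.
  rewrite !ger0_norm ?subr_ge0 ?mono// [s + (t - s)]addrC subrK.
  by apply: powR_increment_le; rewrite // s0.
rewrite !ler0_norm ?subr_le0 ?mono ?(ltW ts)// !opprB.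
apply: (le_trans (powR_increment_le p1 _)); first by rewrite t0 ltW.
rewrite ler_wpM2r ?subr_ge0 ?(ltW ts)// ler_wpM2l//.
have sst : s <= s + (s - t) by rewrite lerDl subr_ge0 ltW.
by apply: ge0_ler_powR; rewrite ?nnegrE ?subr_ge0 ?(le_trans s0 sst).
Qed.

(** The nonnegativity of [f] matters at a limit [l = 0], because [powR] is 1 at
    negative bases. *)
Lemma cvg_powR (R : realType) (T : topologicalType) (F : set_system T) {FF : ProperFilter F}
    (f : T -> R) (l p : R) : 0 <= p -> (forall t, 0 <= f t) ->
  f t @[t --> F] --> l -> f t `^ p @[t --> F] --> l `^ p.
Proof.
rewrite le_eqVlt => /predU1P[<-|p0] f0 fl.
  rewrite powRr0 (_ : (fun t => _) = cst 1); first exact: cvg_cst.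
  by apply/funext => t; rewrite powRr0.
have l0 : 0 <= l by apply: (ler_cvg_to (cvg_cst (0 : R)) fl); apply: nearW.
move: l0; rewrite le_eqVlt => /predU1P[l0|l0].
  rewrite -l0 powR0 ?gt_eqF//; rewrite -l0 in fl.
  apply/cvgr0Pnorm_lt => e e0.
  have e'0 : 0 < e `^ p^-1 by exact: powR_gt0.
  move/cvgr0Pnorm_lt : fl => /(_ _ e'0); apply: filterS => t.
  rewrite !ger0_norm ?powR_ge0// => ft.
  have -> : e = (e `^ p^-1) `^ p by rewrite -powRrM mulVf ?gt_eqF// powRr1// ltW.
  by apply: gt0_ltr_powR; rewrite ?nnegrE// ltW.
have cl : {for l, continuous (fun t : R => t `^ p)}.
  apply/differentiable_continuous/derivable1_diffP.
  by have [] := is_derive1_powR p l0.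
exact: (cvg_comp _ _ fl cl).
Qed.

(** Passage to the limit in the difference quotients of [P = q `^ p * W]: the
    increment of [q `^ p] is at most [p q `^ (p - 1)] times that of [g].  The
    alternative in the last hypothesis covers the points near the boundary, where
    the multiplier has a corner but [q] is 0. *)
Lemma derive_product_bound (R : realType) (p x w' : R) (g q W : R -> R) :
  1 <= p -> (forall y, 0 <= q y) -> (forall y, `|q y - q x| <= `|g y - g x|) ->
  derivable g x 1 -> derivable (fun y => q y `^ p * W y) x 1 ->
  {for x, continuous W} -> (q x = 0 \/ is_derive x 1 W w') ->
  `|derive1 (fun y => q y `^ p * W y) x - q x `^ p * w'|
    <= `|W x| * (p * q x `^ (p - 1) * `|derive1 g x|).
Proof.
move=> p1 q0 qg dg dP cW dW.
set P := fun y => q y `^ p * W y.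
have p0 : 0 < p by rewrite (lt_le_trans ltr01).
have shift0 : h + x @[h --> (0 : R)^'] --> x.
  apply: cvg_within_filter.
  have : h + x @[h --> (0 : R)] --> 0 + x by apply: cvgD; [exact: cvg_id|exact: cvg_cst].
  by rewrite add0r.
have cg : {for x, continuous g} by exact/differentiable_continuous/derivable1_diffP.
have quot (f : R -> R) : derivable f x 1 ->
    h^-1 * (f (h + x) - f x) @[h --> 0^'] --> derive1 f x.
  move=> df; have := df; rewrite /derivable => /cvgP.
  rewrite derive1E /derive.
  under [X in X -> _]eq_cvg do rewrite /GRing.scale/= mulr1.
  by apply.
have gdiff : `|g (h + x) - g x| @[h --> (0 : R)^'] --> (0 : R).
  have : `|g (h + x) - g x| @[h --> (0 : R)^'] --> `|g x - g x|.
    apply: cvg_norm; apply: cvgB; last exact: cvg_cst.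
    exact: (cvg_comp _ _ shift0 cg).
  by rewrite subrr normr0.
pose L (h : R) := `|h^-1 * (P (h + x) - P x) - q x `^ p * (h^-1 * (W (h + x) - W x))|.
pose U (h : R) := `|W (h + x)| * (p * (q x + `|g (h + x) - g x|) `^ (p - 1)
   * `|h^-1 * (g (h + x) - g x)|).
have LU h : L h <= U h.
  rewrite /L /U (_ : _ - _ = h^-1 * (W (h + x) * (q (h + x) `^ p - q x `^ p))); last first.
    rewrite /P; ring.
  rewrite !normrM mulrCA; apply: ler_wpM2l => //; rewrite [leRHS]mulrCA.
  apply: ler_wpM2l => //; apply: (le_trans (powRB_le p1 (q0 x) (q0 (h + x)))).
  have qgh := qg (h + x).
  rewrite ler_pM ?mulr_ge0 ?powR_ge0 ?(ltW p0)// ler_wpM2l ?(ltW p0)//.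
  by apply: ge0_ler_powR; rewrite ?nnegrE ?subr_ge0 ?addr_ge0 ?lerD2l.
have cL : L h @[h --> (0 : R)^'] --> `|derive1 P x - q x `^ p * w'|.
  apply: cvg_norm; apply: cvgB; first exact: quot.
  case: dW => [qx0|[dW <-]].
    by under eq_cvg do rewrite qx0 powR0 ?gt_eqF// mul0r;
      rewrite qx0 powR0 ?gt_eqF// mul0r; exact: cvg_cst.
  by apply: cvgMr; rewrite -derive1E; exact: quot.
have cU : U h @[h --> (0 : R)^'] --> `|W x| * (p * q x `^ (p - 1) * `|derive1 g x|).
  apply: cvgM; first by apply: cvg_norm; exact: (cvg_comp _ _ shift0 cW).
  apply: cvgM; last by apply: cvg_norm; exact: quot.
  apply: cvgMr; apply: cvg_powR.
  - by rewrite subr_ge0.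
  - by move=> h; rewrite addr_ge0.
  - have : q x + `|g (h + x) - g x| @[h --> (0 : R)^'] --> q x + 0.
      by apply: cvgD => //; exact: cvg_cst.
    by rewrite addr0.
apply: (ler_cvg_to cL cU); exact: nearW.
Qed.

(** Bernoulli's inequality at [y = p A v d / q], multiplied by
    [q `^ p / d ^+ 2]. *)
Lemma young_pointwise (R : realType) (p r A q d v : R) :
  1 <= r -> r <= p -> 0 < A -> 0 <= q -> 0 < d -> 0 <= v ->
  r * (A / d * (p * q `^ (p - 1) * v)) <=
    (p * A) `^ r * (q `^ (p - r) * v `^ r / d `^ (2 - r)) + (r - 1) * (q `^ p / d ^+ 2).
Proof.
move=> r1 rp A0 q0 d0 v0.
have r0 : 0 < r by rewrite (lt_le_trans ltr01).
have p0 : 0 < p by rewrite (lt_le_trans r0).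
have pA0 : 0 < p * A by rewrite mulr_gt0.
have rhs0 : 0 <= (p * A) `^ r * (q `^ (p - r) * v `^ r / d `^ (2 - r)).
  by rewrite !mulr_ge0 ?invr_ge0 ?powR_ge0.
move: q0; rewrite le_eqVlt => /predU1P[q00|q0].
  rewrite -q00 in rhs0 *.
  have [p1|p1] := eqVneq p 1.
    have rE : r = 1 by apply/eqP; rewrite eq_le r1 -p1 rp.
    have e21 : 2 - 1 = 1 :> R by ring.
    rewrite rE p1 e21 !subrr powRr0 mul0r addr0 !mul1r.
    by rewrite !powRr1 ?(ltW A0) ?(ltW d0)// mulrA mulrAC.
  rewrite [0 `^ (p - 1)]powR0 ?subr_eq0// !(mulr0, mul0r).
  by rewrite [0 `^ p]powR0 ?gt_eqF// mul0r mulr0 addr0.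
have y0 : 0 <= p * A * v * d / q.
  by rewrite !mulr_ge0 ?invr_ge0 ?(ltW p0) ?(ltW A0) ?(ltW d0) ?(ltW q0).
have := powR_ge_tangent y0 r1.
have c0 : 0 < q `^ p / d ^+ 2 by rewrite divr_gt0 ?powR_gt0 ?exprn_gt0.
rewrite -(ler_pM2l c0).
have -> : q `^ p / d ^+ 2 * (p * A * v * d / q) `^ r =
    (p * A) `^ r * (q `^ (p - r) * v `^ r / d `^ (2 - r)).
  have yE : (p * A * v * d / q) `^ r = (p * A) `^ r * v `^ r * d `^ r / q `^ r.
    have qr0 : q `^ r != 0 by rewrite gt_eqF// powR_gt0.
    apply: (mulIf qr0); rewrite divfK// -(powRM _ y0 (ltW q0)) divfK ?gt_eqF//.
    by rewrite !powRM ?mulr_ge0 ?(ltW pA0) ?(ltW d0) ?(ltW p0) ?(ltW A0).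
  have q1 : q `^ (p - r) = q `^ p / q `^ r by rewrite powRB// (gt_eqF q0) implybT.
  have d1 : d `^ (2 - r) = d ^+ 2 / d `^ r.
    by rewrite powRB ?(gt_eqF d0) ?implybT// (powR_mulrn 2 (ltW d0)).
  rewrite yE q1 d1; have : 0 < d `^ r by exact: powR_gt0.
  have : 0 < q `^ r by exact: powR_gt0.
  move: (q `^ r) (d `^ r) (q `^ p) ((p * A) `^ r) (v `^ r) => qr dr qp pAr vr qr0 dr0.
  by field; rewrite !gt_eqF.
have -> : q `^ p / d ^+ 2 * (1 + r * (p * A * v * d / q - 1)) =
    r * (A / d * (p * q `^ (p - 1) * v)) - (r - 1) * (q `^ p / d ^+ 2).
  rewrite -[q `^ p]mulr_powRB1 ?(ltW q0)//; move: (q `^ (p - 1)) => qp.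
  by field; rewrite !gt_eqF.
by rewrite lerBlDr.
Qed.

Lemma abs_continuous_bounded (R : realType) (a b : R) (f : R -> R) :
  a <= b -> abs_continuous a b f ->
  exists2 B : R, 0 <= B & forall x, a <= x <= b -> `|f x| <= B.
Proof.
move=> ab acf; have bvf := abs_continuous_bounded_variation ab acf.
have tvfin : total_variation a b f \is a fin_num by exact/bounded_variationP.
exists (`|f a| + fine (total_variation a b f)).
  by rewrite addr_ge0// fine_ge0// total_variation_ge0.
move=> x /andP[ax xb].
rewrite -[f x](subrK (f a)) addrC (le_trans (ler_normD _ _))// lerD2l.
rewrite -lee_fin fineK// (le_trans (total_variation_ge f ax))//.
by rewrite (total_variationD f ax xb) leeDl// total_variation_ge0.
Qed.

(** The truncation of [|g|] at height [eta]; it vanishes near the zeros of [g],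
    so that its [p]-th power is integrable against the singular weights, and its
    difference quotients are controlled by those of [g]. *)
Definition truncation (R : realType) (eta : R) (g : R -> R) (x : R) : R :=
  Num.max (`|g x| - eta) 0.

Lemma truncation_ge0 (R : realType) (eta : R) (g : R -> R) (x : R) :
  0 <= truncation eta g x.
Proof. by rewrite /truncation le_max lexx orbT. Qed.

Lemma truncation_le (R : realType) (eta : R) (g : R -> R) (x : R) :
  0 <= eta -> truncation eta g x <= `|g x|.
Proof. by move=> e0; rewrite /truncation ge_max normr_ge0 andbT lerBlDr lerDl. Qed.

Lemma truncation_lipschitz (R : realType) (eta : R) (g : R -> R) (x y : R) :
  `|truncation eta g y - truncation eta g x| <= `|g y - g x|.
Proof.
rewrite /truncation; have := ler_dist_dist (g y) (g x).
move: (`|g y|) (`|g x|) (`|g y - g x|) => u v w uvw.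
rewrite (le_trans _ uvw)//; move: uvw => _.
have [h1|h1] := leP (u - eta) 0; have [h2|h2] := leP (v - eta) 0.
- by rewrite subrr normr0.
- by rewrite sub0r normrN ger0_norm ?(ltW h2)// ler0_norm; lra.
- by rewrite subr0 ger0_norm ?(ltW h1)// ger0_norm; lra.
- by rewrite (_ : u - eta - (v - eta) = u - v)//; ring.
Qed.

Lemma truncation_eq0 (R : realType) (eta : R) (g : R -> R) (x : R) :
  `|g x| <= eta -> truncation eta g x = 0.
Proof. by move=> h; rewrite /truncation max_r// subr_le0. Qed.

Lemma abs_continuous_small (R : realType) (a b eta : R) (g : R -> R) :
  a < b -> abs_continuous a b g -> g a = 0 -> g b = 0 -> 0 < eta ->
  exists e : R, [/\ 0 < e, e <= (b - a) / 2 &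
    forall x, a <= x <= b -> bdist a b x <= e -> `|g x| <= eta].
Proof.
move=> ab acg ga gb eta0; have [d d0 H] := acg eta eta0.
have two u v : a <= u -> u <= v -> v <= b -> v - u < d -> `|g v - g u| < eta.
  move=> au uv vb uvd; have := H 1%N (fun=> u) (fun=> v).
  rewrite !big_ord_recl !big_ord0 !addr0; apply => //.
  by move=> i j; rewrite (ord1 i) (ord1 j).
exists (Num.min (d / 2) ((b - a) / 2)); split.
- by rewrite lt_min !divr_gt0// subr_gt0.
- by rewrite ge_min lexx orbT.
move=> x /andP[ax xb]; rewrite /bdist le_min => /andP[xd _].
have {}xd : Num.min (b - x) (x - a) < d by rewrite (le_lt_trans xd)//; lra.
move: xd; rewrite gt_min => /orP[xd|xd]; apply: ltW.
- by have := two x b ax xb (lexx _) xd; rewrite gb sub0r normrN.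
- by have := two a x (lexx _) ax xb xd; rewrite ga subr0.
Qed.

Lemma abs_continuous_product (R : realType) (a b p K eta : R) (g W : R -> R) :
  a <= b -> 1 <= p -> 0 <= K -> abs_continuous a b g ->
  (forall x y, x <= y -> `|W y - W x| <= K * (y - x)) ->
  abs_continuous a b (fun x => truncation eta g x `^ p * W x).
Proof.
move=> ab p1 K0 acg lipW; have p0 : 0 < p by rewrite (lt_le_trans ltr01).
have p10 : 0 <= p - 1 by rewrite subr_ge0.
have [B B0 gB] := abs_continuous_bounded ab acg.
pose q := truncation eta g.
have q0 x : 0 <= q x := truncation_ge0 eta g x.
have acq : abs_continuous a b q.
  apply: (abs_continuous_dominated ler01 acg acg) => x y _ _ _; rewrite mul1r.
  by rewrite (le_trans (truncation_lipschitz _ _ _ _))// lerDl.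
have [C C0 qC] := abs_continuous_bounded ab acq.
have qC' x : a <= x <= b -> q x <= C by move=> /qC; rewrite ger0_norm.
pose D := `|W a| + K * (b - a).
have D0 : 0 <= D by rewrite addr_ge0// mulr_ge0// subr_ge0.
have WD x : a <= x <= b -> `|W x| <= D.
  move=> /andP[ax xb]; rewrite -[W x](subrK (W a)) addrC (le_trans (ler_normD _ _))// lerD2l.
  by rewrite (le_trans (lipW _ _ ax))// ler_wpM2l// lerD2r.
pose M := D * (p * (3 * C) `^ (p - 1)) + C `^ p * K.
have M1 : 0 <= D * (p * (3 * C) `^ (p - 1)) by rewrite !mulr_ge0 ?powR_ge0 ?(ltW p0).
have M2 : 0 <= C `^ p * K by rewrite mulr_ge0 ?powR_ge0.
apply: (@abs_continuous_dominated R a b M g id) => //.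
- by rewrite addr_ge0.
- exact: abs_continuous_id.
move=> x y ax xy yb.
have xab : a <= x <= b by rewrite ax (le_trans xy).
have yab : a <= y <= b by rewrite yb (le_trans ax).
have -> : q y `^ p * W y - q x `^ p * W x =
    W y * (q y `^ p - q x `^ p) + q x `^ p * (W y - W x) by ring.
rewrite (le_trans (ler_normD _ _))// !normrM mulrDr /=.
apply: lerD; rewrite mulrDl.
  apply: (@le_trans _ _ (D * (p * (3 * C) `^ (p - 1)) * `|g y - g x|)); last first.
    by rewrite lerDl mulr_ge0.
  rewrite -mulrA ler_pM ?WD//.
  apply: (le_trans (powRB_le p1 (q0 x) (q0 y))).
  rewrite ler_pM ?mulr_ge0 ?powR_ge0 ?(ltW p0) ?truncation_lipschitz// ler_wpM2l ?(ltW p0)//.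
  have h : q x + `|q y - q x| <= 3 * C.
    have := ler_normB (q y) (q x); rewrite [`|q y|]ger0_norm// [`|q x|]ger0_norm//.
    have := qC' x xab; have := qC' y yab; lra.
  by apply: ge0_ler_powR => //; rewrite nnegrE ?addr_ge0 ?mulr_ge0.
apply: (@le_trans _ _ (C `^ p * K * `|y - x|)); last by rewrite lerDr mulr_ge0.
rewrite -mulrA ler_pM//.
  rewrite ger0_norm ?powR_ge0//.
  by apply: ge0_ler_powR; rewrite ?nnegrE ?(ltW p0)// qC'.
by rewrite [`|y - x|]ger0_norm ?subr_ge0// lipW.
Qed.

(** * The integral inequality *)

(** The integral of a nonnegative function is a supremum over simple functions
    below it, so it is monotone even when the larger function is not measurable. *)
Lemma ge0_le_integral_nonmeasurable d (T : measurableType d) (R : realType)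
    (mu : {measure set T -> \bar R}) (D E : set T) (f g : T -> \bar R) :
  D `<=` E -> (forall x, D x -> (0 <= f x)%E) -> (forall x, E x -> (0 <= g x)%E) ->
  (forall x, D x -> (f x <= g x)%E) ->
  (\int[mu]_(x in D) f x <= \int[mu]_(x in E) g x)%E.
Proof.
move=> DE f0 g0 fg; rewrite !ge0_integralE//; apply: ereal_sup_le => _ [h /= hf <-].
exists h => //= x; apply: (le_trans (hf x)); rewrite !patchE.
case: ifPn => xD; last by case: ifPn => // /set_mem; exact: g0.
by rewrite mem_set; [exact/fg/set_mem|exact/DE/set_mem].
Qed.

(** The larger function will be an expression in the derivative of an absolutely
    continuous function, which agrees with a measurable function only up to a
    null set and takes arbitrary values on that set. *)
Lemma le_integral_ae_nonmeasurable d (T : measurableType d) (R : realType)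
    (mu : {measure set T -> \bar R}) (E : set T) (f g : T -> \bar R) :
  measurable E -> mu.-integrable E f -> (forall x, E x -> (0 <= g x)%E) ->
  {ae mu, forall x, E x -> (f x <= g x)%E} ->
  (\int[mu]_(x in E) f x <= \int[mu]_(x in E) g x)%E.
Proof.
move=> mE intf g0 [N [mN N0 fgN]].
have intp := integrable_funepos mE intf.
apply: (@le_trans _ _ (\int[mu]_(x in E) f^\+ x)%E).
  apply: le_integral => // x _; rewrite funeposE le_max lexx//.
rewrite (negligible_integral mN mE intp N0).
apply: ge0_le_integral_nonmeasurable => //.
move=> x [Ex Nx]; rewrite funeposE ge_max g0// andbT.
by apply: contrapT => h; apply: Nx; apply: fgN => /= /(_ Ex).
Qed.

(** The inequality to be integrated.  The derivative of [P] bounds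
    [q `^ p * w] up to [|W| * p * q `^ (p - 1) * |g'|], where [w] is the weight;
    Bernoulli's inequality splits the latter product, and its part
    [(r - 1) q `^ p / delta ^+ 2] accounts for the coefficient
    [1 - r + r * kappa].  Where [delta <= e] the function [q] vanishes, so that
    the truncation of the multiplier does no harm. *)
Lemma pointwise_hardy (R : realType) (a b p r m kappa gam A eta e x : R) (g : R -> R) :
  1 <= r -> r <= p -> 1 < m -> 0 <= kappa -> 0 <= gam -> 0 < A -> a < b ->
  (forall s, 0 <= s <= 1 -> kappa * (1 - s) + gam * ((s - s `^ m) / (m - 1)) <= A) ->
  0 < eta -> 0 < e -> e <= (b - a) / 2 ->
  (forall y, a <= y <= b -> bdist a b y <= e -> `|g y| <= eta) ->
  a < x < b -> x != (a + b) / 2 -> derivable g x 1 ->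
  let q := truncation eta g in
  let P := fun y => q y `^ p * hardy_multiplier kappa gam m a b e y in
  derivable P x 1 ->
  (1 - r + r * kappa) * (q x `^ p / bdist a b x ^+ 2)
    + r * gam / ((b - a) / 2) `^ m * (q x `^ p / bdist a b x `^ (2 - m))
    + r * derive1 P x
  <= (p * A) `^ r *
      (`|g x| `^ (p - r) * `|derive1 g x| `^ r / bdist a b x `^ (2 - r)).
Proof.
move=> r1 rp m1 k0 g0 A0 ab H eta0 e0 ed small /[dup] xab /andP[ax xb] xc dg q P dP.
have p1 : 1 <= p by rewrite (le_trans r1).
have p0 : 0 < p by rewrite (lt_le_trans ltr01).
have r0 : 0 < r by rewrite (lt_le_trans ltr01).
have d0 : 0 < bdist a b x by rewrite /bdist lt_min !subr_gt0 ax xb.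
have q0 y : 0 <= q y := truncation_ge0 eta g y.
set W := hardy_multiplier kappa gam m a b e in P dP *.
have [K K0 lipW] := hardy_multiplier_lipschitz k0 g0 m1 e0 ed.
have acW : abs_continuous (x - 1) (x + 1) W.
  apply: (abs_continuous_dominated K0 (@abs_continuous_id R _ _) (@abs_continuous_id R _ _)).
  move=> y z _ yz _; rewrite (le_trans (lipW _ _ yz))// ler_wpM2l//.
  by rewrite (le_trans (ler_norm _))// lerDl.
have cW : {for x, continuous W}.
  by apply: (abs_continuous_cvg acW); rewrite ltrBlDr ltrDl ltr01.
pose w := kappa / bdist a b x ^+ 2 + gam / ((b - a) / 2) `^ m / bdist a b x `^ (2 - m).
have dW : q x = 0 \/ is_derive x 1 W (- w).
  have [xe|ex] := leP (bdist a b x) e; last by right; exact: is_derive_hardy_multiplier.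
  by left; apply: truncation_eq0; apply: small => //; rewrite !ltW.
have qg y : `|q y - q x| <= `|g y - g x| by exact: truncation_lipschitz.
have := derive_product_bound p1 q0 qg dg dP cW dW; rewrite -/P.
have := hardy_multiplier_bound k0 g0 m1 ab e0 ed H xab; rewrite -/W => WA.
move=> /(le_trans (ler_norm _)) bound.
have Y := young_pointwise r1 rp A0 (q0 x) d0 (normr_ge0 (derive1 g x)).
have V0 : 0 <= p * q x `^ (p - 1) * `|derive1 g x|.
  by rewrite !mulr_ge0 ?powR_ge0 ?(ltW p0).
have {}bound : r * (derive1 P x - q x `^ p * - w) <=
    r * (A / bdist a b x * (p * q x `^ (p - 1) * `|derive1 g x|)).
  by rewrite ler_pM2l// (le_trans bound)// ler_wpM2r.
have {}Y := le_trans bound Y.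
have Z : (p * A) `^ r * (q x `^ (p - r) * `|derive1 g x| `^ r / bdist a b x `^ (2 - r)) <=
    (p * A) `^ r * (`|g x| `^ (p - r) * `|derive1 g x| `^ r / bdist a b x `^ (2 - r)).
  rewrite ler_wpM2l ?powR_ge0// ler_wpM2r ?invr_ge0 ?powR_ge0//.
  rewrite ler_wpM2r ?powR_ge0//; apply: ge0_ler_powR; rewrite ?nnegrE ?subr_ge0//.
  exact/truncation_le/ltW.
apply: le_trans Z; move: Y; rewrite -lerBlDr; apply: le_trans.
rewrite le_eqVlt; apply/orP; left; apply/eqP; rewrite /w.
move: (derive1 P x) (q x `^ p) (bdist a b x ^- 2) ((bdist a b x `^ (2 - m))^-1)
  ((((b - a) / 2) `^ m)^-1) => *; ring.
Qed.

Lemma abs_continuous_measurable (R : realType) (a b : R) (g : R -> R) : a <= b ->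
  abs_continuous a b g -> measurable_fun `[a, b]%classic g.
Proof.
move=> ab acg.
have cg : continuous (g \o clip a b).
  move=> x; apply: (@abs_continuous_cvg _ (x - 1) (x + 1)); first exact: abs_continuous_clip.
  by rewrite ltrBlDr ltrDl ltr01.
apply: (@eq_measurable_fun _ _ _ _ _ (g \o clip a b)).
  by move=> x; rewrite inE/= in_itv/= => xab; rewrite /= clip_id.
by apply: measurable_funTS; exact: continuous_measurable_fun.
Qed.

Lemma bdist_ge0 (R : realType) (a b x : R) : a <= x <= b -> 0 <= bdist a b x.
Proof. by move=> /andP[ax xb]; rewrite /bdist le_min !subr_ge0 ax xb. Qed.

Lemma bdist_le (R : realType) (a b x : R) : bdist a b x <= (b - a) / 2.
Proof.
rewrite /bdist ge_min; have [?|?] := leP x ((a + b) / 2); apply/orP; [right|left]; lra.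
Qed.

Lemma measurable_bdist (R : realType) (a b : R) (D : set R) :
  measurable_fun D (bdist a b).
Proof.
rewrite /bdist; apply: (@measurable_minr _ _ _ D (fun x => b - x) (fun x => x - a)).
- by apply: measurable_funB.
- by apply: measurable_funB.
Qed.

Lemma measurable_powR_div_bdist (R : realType) (a b p s : R) (u : R -> R) :
  measurable_fun `[a, b]%classic u ->
  measurable_fun `[a, b]%classic (fun x => u x `^ p / bdist a b x `^ s).
Proof.
move=> mu; rewrite (_ : (fun x => _) = (fun x => u x `^ p * bdist a b x `^ (- s))).
  apply: measurable_funM; first exact: measurableT_comp (measurable_powR _) mu.
  by apply: measurableT_comp (measurable_powR _) _; exact: measurable_bdist.
by apply/funext => x; rewrite powRN.
Qed.

Lemma measurable_powR_div_bdist2 (R : realType) (a b p : R) (u : R -> R) :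
  measurable_fun `[a, b]%classic u ->
  measurable_fun `[a, b]%classic (fun x => u x `^ p / bdist a b x ^+ 2).
Proof.
move=> mu; apply: eq_measurable_fun (measurable_powR_div_bdist p 2 mu) => x.
rewrite inE/= in_itv/= => xab.
by rewrite (powR_mulrn 2 (bdist_ge0 xab)).
Qed.

Lemma measurable_truncation (R : realType) (eta : R) (D : set R) (g : R -> R) :
  measurable_fun D g -> measurable_fun D (truncation eta g).
Proof.
move=> mg; rewrite /truncation.
apply: (@measurable_maxr _ _ _ D (fun x => `|g x| - eta) (cst 0)) => //.
apply: measurable_funB => //; exact: measurableT_comp.
Qed.

Lemma lebesgue_measure_itvcc_lty (R : realType) (a b : R) :
  (@lebesgue_measure R `[a, b]%classic < +oo)%E.
Proof. by rewrite lebesgue_measure_itv/=; case: ifPn => _; rewrite -?EFinB ltry. Qed.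

(** Where [delta <= e] the truncation vanishes, so the singular weights only
    matter where they are bounded. *)
Lemma truncation_quotient_bound (R : realType) (a b p eta e B x : R) (g : R -> R) :
  0 < p -> 0 < e -> 0 < eta ->
  (forall y, a <= y <= b -> bdist a b y <= e -> `|g y| <= eta) ->
  (forall y, a <= y <= b -> `|g y| <= B) -> a <= x <= b ->
  0 <= truncation eta g x `^ p / bdist a b x ^+ 2 <= B `^ p / e ^+ 2.
Proof.
move=> p0 e0 eta0 small gB xab; set q := truncation eta g.
have d0 := bdist_ge0 xab.
have q0 : 0 <= q x := truncation_ge0 eta g x.
have qB : q x <= B by rewrite (le_trans (truncation_le _ _ (ltW eta0)))// gB.
have B0 := le_trans q0 qB.
rewrite divr_ge0 ?powR_ge0 ?exprn_ge0//=.
have [xe|ex] := leP (bdist a b x) e.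
  rewrite /q truncation_eq0; last exact: small.
  by rewrite powR0 ?gt_eqF// mul0r divr_ge0 ?powR_ge0 ?exprn_ge0// ltW.
have dx0 := lt_trans e0 ex.
apply: ler_pM; rewrite ?powR_ge0 ?invr_ge0 ?exprn_ge0//.
  by apply: ge0_ler_powR; rewrite ?nnegrE ?(ltW p0).
by rewrite lef_pV2 ?posrE ?exprn_gt0// ler_pXn2r ?nnegrE ?(ltW e0)// ltW.
Qed.

Lemma integrable_truncation_quotient2 (R : realType) (a b p eta e B : R) (g : R -> R) :
  0 < p -> 0 < e -> 0 < eta -> measurable_fun `[a, b]%classic g ->
  (forall y, a <= y <= b -> bdist a b y <= e -> `|g y| <= eta) ->
  (forall y, a <= y <= b -> `|g y| <= B) ->
  lebesgue_measure.-integrable `[a, b]%classic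
    (EFin \o (fun x => truncation eta g x `^ p / bdist a b x ^+ 2)).
Proof.
move=> p0 e0 eta0 mg small gB.
apply: measurable_bounded_integrable => //.
- exact: lebesgue_measure_itvcc_lty.
- by apply: measurable_powR_div_bdist2; exact: measurable_truncation.
exists (B `^ p / e ^+ 2); split; first exact: num_real.
move=> M BM x /=; rewrite in_itv/= => xab.
have /andP[h0 h1] := truncation_quotient_bound p0 e0 eta0 small gB xab.
by rewrite ger0_norm// (le_trans h1)// ltW.
Qed.

Lemma integrable_truncation_quotient (R : realType) (a b p m eta e B : R) (g : R -> R) :
  0 < p -> 1 < m -> 0 < e -> 0 < eta -> measurable_fun `[a, b]%classic g ->
  (forall y, a <= y <= b -> bdist a b y <= e -> `|g y| <= eta) ->
  (forall y, a <= y <= b -> `|g y| <= B) ->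
  lebesgue_measure.-integrable `[a, b]%classic
    (EFin \o (fun x => truncation eta g x `^ p / bdist a b x `^ (2 - m))).
Proof.
move=> p0 m1 e0 eta0 mg small gB.
apply: measurable_bounded_integrable => //.
- exact: lebesgue_measure_itvcc_lty.
- by apply: measurable_powR_div_bdist; exact: measurable_truncation.
exists (B `^ p / e ^+ 2 * ((b - a) / 2) `^ m); split; first exact: num_real.
move=> M BM x /=; rewrite in_itv/= => xab.
have /andP[h0 h1] := truncation_quotient_bound p0 e0 eta0 small gB xab.
have d0 := bdist_ge0 xab.
rewrite ger0_norm ?divr_ge0 ?powR_ge0// (le_trans _ (ltW BM))//.
have [dE|dn0] := eqVneq (bdist a b x) 0.
  rewrite truncation_eq0; last by apply: small; rewrite // dE ltW.
  rewrite powR0 ?gt_eqF// mul0r mulr_ge0 ?powR_ge0//; exact: le_trans h1.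
rewrite powRB ?dn0 ?implybT// (powR_mulrn 2 d0) invf_div mulrCA mulrC.
rewrite ler_pM ?powR_ge0//.
have dd := bdist_le a b x.
have m0 : 0 <= m by rewrite ltW// (lt_trans ltr01).
by apply: ge0_ler_powR => //; rewrite nnegrE// (le_trans d0).
Qed.

Lemma ae_neq (R : realType) (c : R) : {ae @lebesgue_measure R, forall x, x <> c}.
Proof.
exists [set c]; split; first exact: measurable_set1.
  exact: lebesgue_measure_set1.
by move=> x /= /contrapT.
Qed.

(** Integration of the pointwise inequality: [P] vanishes at both ends, so the
    integral of its derivative is 0. *)
Lemma hardy_truncated (R : realType) (a b p r m kappa gam A eta : R) (g : R -> R) :
  1 <= r -> r <= p -> 1 < m -> 0 <= kappa -> 0 <= gam -> 0 < A -> a < b ->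
  (forall s, 0 <= s <= 1 -> kappa * (1 - s) + gam * ((s - s `^ m) / (m - 1)) <= A) ->
  abs_continuous a b g -> g a = 0 -> g b = 0 -> 0 < eta ->
  ((1 - r + r * kappa)%:E *
      \int[lebesgue_measure]_(x in `[a, b]) (truncation eta g x `^ p / bdist a b x ^+ 2)%:E
    + (r * gam / ((b - a) / 2) `^ m)%:E *
      \int[lebesgue_measure]_(x in `[a, b])
        (truncation eta g x `^ p / bdist a b x `^ (2 - m))%:E
  <= ((p * A) `^ r)%:E * \int[lebesgue_measure]_(x in `[a, b])
      (`|g x| `^ (p - r) * `|derive1 g x| `^ r / bdist a b x `^ (2 - r))%:E)%E.
Proof.
move=> r1 rp m1 k0 g0 A0 ab H acg ga gb eta0.
set q := truncation eta g; set mu := @lebesgue_measure R.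
have p1 : 1 <= p by rewrite (le_trans r1).
have p0 : 0 < p by rewrite (lt_le_trans ltr01).
have [e [e0 ed small]] := abs_continuous_small ab acg ga gb eta0.
have [B B0 gB] := abs_continuous_bounded (ltW ab) acg.
have mg := abs_continuous_measurable (ltW ab) acg.
pose W := hardy_multiplier kappa gam m a b e.
pose P y := q y `^ p * W y.
have [K K0 lipW] := hardy_multiplier_lipschitz k0 g0 m1 e0 ed.
have acP : abs_continuous a b P by exact: (abs_continuous_product _ (ltW ab) p1 K0 acg lipW).
have [h [ih hE aeP]] := abs_continuous_FTC ab acP.
have [hg [_ _ aeg]] := abs_continuous_FTC ab acg.
have Pa : P a = 0.
  by rewrite /P /q truncation_eq0 ?ga ?normr0 ?(ltW eta0)// powR0 ?gt_eqF// mul0r.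
have Pb : P b = 0.
  by rewrite /P /q truncation_eq0 ?gb ?normr0 ?(ltW eta0)// powR0 ?gt_eqF// mul0r.
have I1 := integrable_truncation_quotient2 p0 e0 eta0 mg small gB.
have I2 := integrable_truncation_quotient p0 m1 e0 eta0 mg small gB.
rewrite -/q in I1 I2.
have mE : measurable (`[a, b]%classic : set (measurableTypeR R)) by exact: measurable_itv.
have Ih : mu.-integrable `[a, b]%classic (EFin \o h) by exact: integrableS ih.
have h0 : (\int[mu]_(x in `[a, b]) (h x)%:E = 0)%E.
  rewrite -integral_itv_obnd_cbnd; first by rewrite -hE Pa Pb subrr.
  by have /integrableP[] : mu.-integrable `]a, b]%classic (EFin \o h) by exact: integrableS ih.
set k := 1 - r + r * kappa; set c := r * gam / ((b - a) / 2) `^ m.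
pose F1 x := q x `^ p / bdist a b x ^+ 2.
pose F2 x := q x `^ p / bdist a b x `^ (2 - m).
have I1k : mu.-integrable `[a, b]%classic (fun x => k%:E * (F1 x)%:E)%E by exact: integrableZl.
have I2c : mu.-integrable `[a, b]%classic (fun x => c%:E * (F2 x)%:E)%E by exact: integrableZl.
have Ihr : mu.-integrable `[a, b]%classic (fun x => r%:E * (h x)%:E)%E by exact: integrableZl.
pose Z x := (k%:E * (F1 x)%:E + c%:E * (F2 x)%:E + r%:E * (h x)%:E)%E.
have I12 : mu.-integrable `[a, b]%classic (fun x => k%:E * (F1 x)%:E + c%:E * (F2 x)%:E)%E.
  exact: integrableD.
have IZ : mu.-integrable `[a, b]%classic Z by exact: integrableD.
have -> : (k%:E * \int[mu]_(x in `[a, b]) (F1 x)%:E +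
      c%:E * \int[mu]_(x in `[a, b]) (F2 x)%:E)%E
    = (\int[mu]_(x in `[a, b]) Z x)%E.
  by rewrite integralD// integralD// !integralZl// h0 mule0 adde0.
have C0 : 0 < (p * A) `^ r by rewrite powR_gt0// mulr_gt0.
have -> : (\int[mu]_(x in `[a, b]) Z x = ((p * A) `^ r)%:E *
   \int[mu]_(x in `[a, b]) (((p * A) `^ r)^-1%:E * Z x))%E.
  by rewrite integralZl// muleA -EFinM divff ?gt_eqF// mul1e.
apply: lee_wpmul2l; first by rewrite lee_fin ltW.
apply: le_integral_ae_nonmeasurable => //.
- exact: integrableZl.
- by move=> x _; rewrite lee_fin !mulr_ge0 ?invr_ge0 ?powR_ge0.
have aeN := ae_filter_ringOfSetsType mu.
have aeab := @filterI _ _ aeN _ _ (ae_neq a) (ae_neq b).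
have ae1 := @filterI _ _ aeN _ _ aeab (ae_neq ((a + b) / 2)).
have ae2 := @filterI _ _ aeN _ _ aeP aeg.
apply: (@filterS2 _ _ aeN _ _ _ _ ae1 ae2) => x [[/eqP xa /eqP xb] /eqP xc] [HP Hg] /=.
rewrite in_itv/= => /andP[ax xb'].
have xab : a < x < b by rewrite !lt_neqAle ax xb' [a == x]eq_sym xa xb.
have [dP hx] := HP xab; have [dg _] := Hg xab.
rewrite /Z -!EFinM lee_fin -(ler_pM2l C0) mulrA divff ?gt_eqF// mul1r -hx.
by apply: (pointwise_hardy r1 rp m1 k0 g0 A0 ab H eta0 e0 ed small xab).
Qed.

Lemma truncation_nincr (R : realType) (eta eta' : R) (g : R -> R) (x : R) :
  eta' <= eta -> truncation eta g x <= truncation eta' g x.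
Proof.
move=> ee; rewrite /truncation ge_max !le_max lexx orbT andbT.
by rewrite lerD2l lerN2 ee.
Qed.

Lemma truncation_cvg (R : realType) (g : R -> R) (x : R) :
  truncation (harmonic n) g x @[n --> \oo] --> `|g x|.
Proof.
apply/cvgrPdist_le => e e0; have := @cvg_harmonic R => /cvgrPdist_le/(_ _ e0).
apply: filterS => n; rewrite sub0r normrN => ne.
have h0 : 0 <= harmonic n :> R by rewrite harmonic_ge0.
rewrite ger0_norm in ne => //.
have tle := truncation_le g x h0.
rewrite ger0_norm ?subr_ge0//; rewrite /truncation.
by rewrite lerBlDr -lerBlDl (le_trans (y := `|g x| - harmonic n)) ?le_max ?lexx// lerD2l lerN2.
Qed.

Lemma truncation_integral_cvg (R : realType) (a b p : R) (g phi : R -> R) : 0 < p ->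
  (forall x, a <= x <= b -> 0 <= phi x) ->
  (forall eta, measurable_fun `[a, b]%classic (fun x => truncation eta g x `^ p * phi x)) ->
  (\int[lebesgue_measure]_(x in `[a, b]) (truncation (harmonic n) g x `^ p * phi x)%:E)%E
    @[n --> \oo] -->
  (\int[lebesgue_measure]_(x in `[a, b]) (`|g x| `^ p * phi x)%:E)%E.
Proof.
move=> p0 phi0 mt.
have mE : measurable (`[a, b]%classic : set (measurableTypeR R)) by exact: measurable_itv.
have t0 eta x : 0 <= truncation eta g x by exact: truncation_ge0.
have -> : (\int[lebesgue_measure]_(x in `[a, b]) (`|g x| `^ p * phi x)%:E)%E =
    (\int[lebesgue_measure]_(x in `[a, b])
       limn (fun n => (truncation (harmonic n) g x `^ p * phi x)%:E))%E.
  apply: eq_integral => x _; apply/esym/cvg_lim => //.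
  apply: cvg_EFin; first exact: nearW.
  apply: cvgMl; apply: cvg_powR; [exact: ltW|by []|exact: truncation_cvg].
apply: cvg_monotone_convergence => //.
- by move=> n; apply/measurable_EFinP; exact: mt.
- by move=> n x /=; rewrite in_itv/= => xab; rewrite lee_fin mulr_ge0 ?powR_ge0// phi0.
move=> x /=; rewrite in_itv/= => xab n n' nn'.
rewrite lee_fin ler_wpM2r ?phi0//; apply: ge0_ler_powR; rewrite ?nnegrE ?(ltW p0)//.
by apply: truncation_nincr; rewrite lef_pV2 ?posrE// ler_nat ltnS.
Qed.

(** The inequality for the truncations passes to the limit by monotone
    convergence.  When the first integral diverges and its coefficient is
    negative, the left side is [-oo]. *)
Lemma hardy_inequality (R : realType) (a b p r m kappa gam A : R) (g : R -> R) :
  1 <= r -> r <= p -> 1 < m -> 0 <= kappa -> 0 <= gam -> 0 < A -> a < b ->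
  (forall s, 0 <= s <= 1 -> kappa * (1 - s) + gam * ((s - s `^ m) / (m - 1)) <= A) ->
  abs_continuous a b g -> g a = 0 -> g b = 0 ->
  ((1 - r + r * kappa)%:E *
      \int[lebesgue_measure]_(x in `[a, b]) (`|g x| `^ p / bdist a b x ^+ 2)%:E
    + (r * gam / ((b - a) / 2) `^ m)%:E *
      \int[lebesgue_measure]_(x in `[a, b]) (`|g x| `^ p / bdist a b x `^ (2 - m))%:E
  <= (p `^ r * A `^ r)%:E * \int[lebesgue_measure]_(x in `[a, b])
      (`|g x| `^ (p - r) * `|derive1 g x| `^ r / bdist a b x `^ (2 - r))%:E)%E.
Proof.
move=> r1 rp m1 k0 g0 A0 ab H acg ga gb.
have r0 : 0 < r by rewrite (lt_le_trans ltr01).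
have p0 : 0 < p by rewrite (lt_le_trans r0).
have mg := abs_continuous_measurable (ltW ab) acg.
rewrite -powRM ?(ltW p0) ?(ltW A0)//.
set M := (X in (_ <= X)%E).
set k := 1 - r + r * kappa; set c := r * gam / ((b - a) / 2) `^ m.
have c0 : 0 <= c by rewrite divr_ge0 ?powR_ge0// mulr_ge0// ltW.
have phi1 x : a <= x <= b -> 0 <= (bdist a b x ^+ 2)^-1.
  by move=> xab; rewrite invr_ge0 exprn_ge0// bdist_ge0.
have phi2 x : a <= x <= b -> 0 <= (bdist a b x `^ (2 - m))^-1.
  by move=> _; rewrite invr_ge0 powR_ge0.
have I1 := truncation_integral_cvg p0 phi1
  (fun eta => measurable_powR_div_bdist2 p (measurable_truncation eta mg)).
have I2 := truncation_integral_cvg p0 phi2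
  (fun eta => measurable_powR_div_bdist p (2 - m) (measurable_truncation eta mg)).
have trunc n : _ := hardy_truncated r1 rp m1 k0 g0 A0 ab H acg ga gb (harmonic_gt0 n).
rewrite -/k -/c -/M in trunc.
set J1 := (X in (k%:E * X + _)%E); set J2 := (X in (_ + c%:E * X)%E).
have J10 : (0 <= J1)%E.
  apply: integral_ge0 => x /=; rewrite in_itv/= => xab.
  by rewrite lee_fin mulr_ge0 ?powR_ge0// phi1.
have J20 : (0 <= J2)%E.
  apply: integral_ge0 => x /=; rewrite in_itv/= => xab.
  by rewrite lee_fin mulr_ge0 ?powR_ge0// phi2.
have [/andP[kneg J1oo]|kJ] := boolP ((k < 0) && (J1 == +oo%E)).
  by rewrite (eqP J1oo) mulry ltr0_sg// mulN1e addNye leNye.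
have def : (k%:E * J1 +? c%:E * J2)%E.
  have c2 : (0 <= c%:E * J2)%E by rewrite mule_ge0.
  move: kJ; rewrite negb_and -leNgt => /orP[kpos|Jfin].
    by rewrite ge0_adde_def// inE mule_ge0.
  by rewrite fin_num_adde_defr// fin_numM// ge0_fin_numE// ltey.
have L1 := cvgeZl (isT : k%:E \is a fin_num) I1.
have L2 := cvgeZl (isT : c%:E \is a fin_num) I2.
apply: (cvge_le _ (cvgeD def L1 L2)); apply: nearW => n; exact: trunc.
Qed.

(** * The two parts of the theorem *)

Theorem theorem2 (R : realType) (a b p r : R) (g : R -> R)
    (hab : a < b) (hp : 1 <= p) (hr : 1 <= r <= p)
    (hg : abs_continuous a b g) (hga : g a = 0) (hgb : g b = 0) :
  let mu := @lebesgue_measure R in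
  let delta := bdist a b in
  let delta0 := (b - a) / 2 in
  (forall m nu lambda : R,
     1 < m -> 0 <= nu <= 1 / m -> 0 <= lambda < (1 + nu * m) / 2 ->
     ((1 - r * nu ^+ 2 * m ^+ 2)%:E *
        \int[mu]_(x in `[a, b]) (`|g x| `^ p / delta x ^+ 2)%:E
      + (4 * r * (bessel_c nu m lambda ^+ 2 + (m - 1) * (lambda - lambda ^+ 2))
           / delta0 `^ m)%:E *
        \int[mu]_(x in `[a, b]) (`|g x| `^ p / delta x `^ (2 - m))%:E
      <= (p `^ r * (2 * (1 + nu * m) - 4 * lambda ^+ 2) `^ r)%:E *
         \int[mu]_(x in `[a, b])
           (`|g x| `^ (p - r) * `|derive1 g x| `^ r / delta x `^ (2 - r))%:E)%E)
  /\
  (forall m nu lambda : R,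
     1 < m -> 0 <= nu < 1 / m -> 0 <= lambda < (1 + nu * m) / 2 ->
     (\int[mu]_(x in `[a, b]) (`|g x| `^ p / delta x ^+ 2)%:E
      + (4 * r * (bessel_c nu m lambda ^+ 2 + (m - 1) * (lambda - lambda ^+ 2))
           / ((1 - nu ^+ 2 * m ^+ 2) * delta0 `^ m))%:E *
        \int[mu]_(x in `[a, b]) (`|g x| `^ p / delta x `^ (2 - m))%:E
      <= (p `^ r * (2 / (1 - nu * m)
                    - 4 * lambda ^+ 2 / (1 - nu ^+ 2 * m ^+ 2)) `^ r)%:E *
         \int[mu]_(x in `[a, b])
           (`|g x| `^ (p - r) * `|derive1 g x| `^ r / delta x `^ (2 - r))%:E)%E).
Proof.
move=> mu delta delta0; case/andP: hr => r1 rp.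
have params (m nu lambda : R) : 1 < m -> 0 <= nu <= 1 / m ->
    0 <= lambda < (1 + nu * m) / 2 ->
    let C := 4 * (bessel_c nu m lambda ^+ 2 + (m - 1) * (lambda - lambda ^+ 2)) in
    let A := 2 * (1 + nu * m) - 4 * lambda ^+ 2 in
    [/\ 0 <= nu * m <= 1, 0 <= C, 0 < A & forall s, 0 <= s <= 1 ->
      (1 - nu ^+ 2 * m ^+ 2) * (1 - s) + C * ((s - s `^ m) / (m - 1)) <= A].
  move=> m1 num /[dup] lam /andP[l0 lal] C A.
  have m0 : 0 < m by rewrite (lt_trans ltr01).
  have num1 : 0 <= nu * m <= 1.
    by case/andP: num => nu0; rewrite ler_pdivlMr// => ->; rewrite mulr_ge0// ltW.
  have l1 : lambda < 1 by case/andP: num1 => _ ?; lra.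
  have l2 : lambda ^+ 2 <= lambda by rewrite expr2 ler_piMl// ltW.
  split => //.
  - by rewrite mulr_ge0// addr_ge0 ?sqr_ge0// mulr_ge0// subr_ge0// ltW.
  - rewrite /A; lra.
  - move=> s s01; exact: weight_bound m1 num lam (bessel_c_bound m1 num lam) s01.
split => m nu lambda m1 num lam.
(* part (i): [kappa = 1 - nu ^+ 2 * m ^+ 2] and [gam = C] *)
- have [/andP[nm0 nm1] C0 A0 H] := params m nu lambda m1 num lam.
  have q0 : 0 <= 1 - nu ^+ 2 * m ^+ 2 by rewrite subr_ge0 -exprMn exprn_ile1.
  have := hardy_inequality r1 rp m1 q0 C0 A0 hab H hg hga hgb.
  congr (is_true (_ + _ <= _)%E); congr (_%:E * _)%E; first by ring.
  by congr (_ / _); ring.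
(* part (ii): the constants of part (i) divided by [q = 1 - nu ^+ 2 * m ^+ 2] *)
have {}num' : 0 <= nu <= 1 / m by case/andP: num => -> /ltW.
have [/andP[nm0 nm1] C0 A0 H] := params m nu lambda m1 num' lam.
have m0 : 0 < m by rewrite (lt_trans ltr01).
have nmlt : nu * m < 1 by case/andP: num => _; rewrite ltr_pdivlMr.
set q := 1 - nu ^+ 2 * m ^+ 2 in H *.
have q0 : 0 < q by rewrite /q subr_gt0 -exprMn exprn_ilt1.
set C := 4 * _ in C0 H; set A := 2 * _ - _ in A0 H.
have Cq0 : 0 <= C / q by rewrite divr_ge0// ltW.
have Aq0 : 0 < A / q by rewrite divr_gt0.
have Hq s : 0 <= s <= 1 -> 1 * (1 - s) + C / q * ((s - s `^ m) / (m - 1)) <= A / q.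
  move=> s01; rewrite ler_pdivlMr// (le_trans _ (H s s01))//.
  rewrite le_eqVlt; apply/orP; left; apply/eqP; field.
  by rewrite gt_eqF ?subr_gt0// gt_eqF.
have := hardy_inequality r1 rp m1 ler01 Cq0 Aq0 hab Hq hg hga hgb.
congr (is_true (_ + _ <= _)%E).
- by rewrite mulr1 subrK mul1e.
- congr (_%:E * _)%E; rewrite /C.
  have : 0 < delta0 `^ m by rewrite powR_gt0// divr_gt0// subr_gt0.
  rewrite -/delta0; move: (delta0 `^ m) => D D0; field; rewrite !gt_eqF//.
congr ((_ * powR _ _)%:E * _)%E; rewrite /A /q.
have qE : 1 - nu ^+ 2 * m ^+ 2 = (1 - nu * m) * (1 + nu * m) by ring.
have nm1p : 0 < 1 + nu * m by lra.
by rewrite qE; field; rewrite !gt_eqF ?subr_gt0.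
Qed.
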